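(* Let $G$ be a directed or undirected graph with $n$ vertices, $m$ edges and source $s$. In the comparison-addition model, Dijkstra's algorithm implemented with any Fibonacci-like priority queue with the working set property has, on every input $(G,w)$ with $w>0$, time complexity $O(\mathrm{OPT}_Q(G)+m+n)$. Moreover, the number of queries (\textsc{Compare} operations) it makes is $O\big(\mathrm{OPT}_Q(G)+n+\max_{w'>0}|F_{G,w'}|\big)$.
   Context: Graphs: undirected graphs are connected; in directed graphs every vertex is reachable from the source $s$. Edge weights are $w:E(G)\to\mathbb{R}_{>0}$ and $d(s,v)$ is the resulting distance. Distance ordering problem: given $G$, $s$, $w$, output all vertices of $G$ in increasing order of distance from $s$ (a valid output is any ordering in which $u$ precedes $v$ whenever $d(s,u)<d(s,v)$). Comparison-addition model: the Word-RAM model in which the edge weights are stored in protected cells; the only operations allowed on protected cells are \textsc{Add}$(x,y)$, which returns a new protected cell containing $x+y$, and \textsc{Compare}$(x,y)$, which returns $-1,0,1$ according to whether $x<y$, $x=y$, $x>y$. Time complexity is the total number of operations; query complexity is the number of \textsc{Compare} operations. An algorithm is correct if on every input it outputs a valid answer with probability 1. For an algorithm $A$, $A_Q(G,w)$ denotes its expected number of queries on $(G,w)$, and $\mathrm{OPT}_Q(G)=\inf_{A}\sup_{w>0}A_Q(G,w)$, the infimum over all correct algorithms. $F_{G,w}$: for directed $G$, the set of edges $uv$ with $d(s,u)<d(s,v)$; for undirected $G$, the set of edges $uv$ with $d(s,u)\neq d(s,v)$. Working set: in a priority queue supporting \textsc{Insert}, \textsc{ExtractMin} (and \textsc{DecreaseKey},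 \textsc{FindMin}), for an element $x$ and each time $t$ between the insertion and extraction of $x$, $W_{x,t}$ is the set of elements inserted after $x$ that are still present at time $t$, together with $x$ itself; $W_x=W_{x,t_0}$ for a time $t_0$ maximizing $|W_{x,t}|$. A Fibonacci-like priority queue with the working set property is a (comparison-based) priority queue in which, for any sequence of operations, \textsc{Insert}, \textsc{FindMin} and \textsc{DecreaseKey} have amortized cost $O(1)$ and \textsc{ExtractMin} extracting $x$ has amortized cost $O(1+\log|W_x|)$. Dijkstra's algorithm (the version considered): initially insert $s$ with key $0$. While not all vertices are extracted: extract the minimum $(d_u,u)$ and append $u$ to the output; for every edge $uv$ (for undirected graphs, every edge incident to $u$) with $v$ not yet extracted: if $v$ has never been inserted, insert it with key $+\infty$; set $D[v]\gets\min(D[v],d_u+w(uv))$ and call \textsc{DecreaseKey} on $v$ with key $D[v]$ (even if unchanged). Logarithms are base 2. *)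

(* Defs.v *)
From HB Require Import structures.
From mathcomp Require Import all_boot all_order all_algebra.
From mathcomp Require Import all_classical all_reals all_analysis.
Set Implicit Arguments.
Unset Strict Implicit.
Unset Printing Implicit Defensive.
Import Order.TTheory GRing.Theory Num.Theory.
Import numFieldNormedType.Exports.
Local Open Scope classical_set_scope.
Local Open Scope ring_scope.

(** * Graphs and distances *)

(* Edges are indexed, so loops and parallel edges are allowed.  In an
   undirected graph the order of the two endpoints of an edge is irrelevant. *)
Record pregraph := PreGraph {
  nv : nat;
  ne : nat;
  directed : bool;
  src : 'I_nv;
  edge_tail : 'I_ne -> 'I_nv;
  edge_head : 'I_ne -> 'I_nv }.

Definition traverses (G : pregraph) (e : 'I_(ne G)) (u v : 'I_(nv G)) : bool :=
  (edge_tail e == u) && (edge_head e == v)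
  || ~~ directed G && (edge_head e == u) && (edge_tail e == v).

Fixpoint walk (G : pregraph) (u : 'I_(nv G)) (p : seq 'I_(ne G))
    (v : 'I_(nv G)) : bool :=
  if p is e :: p' then [exists x, traverses e u x && walk x p' v] else u == v.

Record graph := Graph {
  pregraph_of :> pregraph;
  graph_connected :
    if directed pregraph_of then
      forall v, exists p, walk (src pregraph_of) p v
    else forall u v : 'I_(nv pregraph_of), exists p, walk u p v }.

Definition positive (R : realType) (E : Type) (w : E -> R) : Prop :=
  forall e, 0 < w e.

Definition dist (R : realType) (G : graph) (w : 'I_(ne G) -> R)
    (v : 'I_(nv G)) : R :=
  inf [set \sum_(e <- p) w e | p in [set p | walk (src G) p v]].

Definition forward_edges (R : realType) (G : graph) (w : 'I_(ne G) -> R) :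
    {set 'I_(ne G)} :=
  if directed G then [set e | dist w (edge_tail e) < dist w (edge_head e)]%SET
  else [set e | dist w (edge_tail e) != dist w (edge_head e)]%SET.

(* The maximum of |F_{G,w}| over all positive w; |F_{G,w}| is at most [ne G]. *)
Definition max_forward (R : realType) (G : graph) : nat :=
  \max_(k < (ne G).+1 |
        `[< exists2 w : 'I_(ne G) -> R,
              positive w & #|forward_edges w| = k >]) k.

(** * The comparison-addition model *)

(* A computation is given by the operations it performs, each of unit cost:
   [Op] is an operation on unprotected words (the unprotected memory itself is
   carried by the continuation), [Flip] draws a fair coin, [PAdd i j] creates a
   new protected cell holding the sum of cells [i] and [j] and passes on its
   address, [PCmp i j] compares two protected cells (the answers -1, 0, 1 are
   [Lt], [Eq], [Gt]).  Control flow cannot depend on protected contents in any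
   other way.  The type is coinductive because a randomized algorithm may fail
   to terminate on a null set. *)
CoInductive computation (A : Type) : Type :=
| Ret of A
| Op of computation A
| Flip of (bool -> computation A)
| PAdd of nat & nat & (nat -> computation A)
| PCmp of nat & nat & (comparison -> computation A).

Arguments Ret {A}.
Arguments Op {A}.
Arguments Flip {A}.
Arguments PAdd {A}.
Arguments PCmp {A}.

CoFixpoint bind (A B : Type) (c : computation A) (f : A -> computation B) :
    computation B :=
  match c with
  | Ret a => f a
  | Op c' => Op (bind c' f)
  | Flip k => Flip (fun b => bind (k b) f)
  | PAdd i j k => PAdd i j (fun x => bind (k x) f)
  | PCmp i j k => PCmp i j (fun x => bind (k x) f)
  end.

Notation "'let!' x ':=' c 'in' k" := (bind c (fun x => k))
  (at level 200, x pattern, c at level 200, k at level 200).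

(* Contents of a protected cell; an invalid address reads as 0, which is also
   the content of cell 0 in [init_cells]. *)
Definition cell (R : realType) (mem : seq (\bar R)) (i : nat) : \bar R :=
  nth 0%E mem i.

Definition compare_cells (R : realType) (mem : seq (\bar R)) (i j : nat) :
    comparison :=
  if (cell mem i < cell mem j)%E then Lt
  else if cell mem i == cell mem j then Eq else Gt.

Record config (R : realType) (A : Type) := Config {
  code : computation A;
  cells : seq (\bar R);
  coins : nat -> bool;
  time : nat;
  queries : nat }.

Definition step (R : realType) (A : Type) (s : config R A) : config R A :=
  let: Config c mem tape t q := s in
  match c with
  | Ret _ => s
  | Op c' => Config c' mem tape t.+1 q
  | Flip k => Config (k (tape 0%N)) mem (fun i => tape i.+1) t.+1 q
  | PAdd i j k =>
      Config (k (size mem)) (rcons mem (cell mem i + cell mem j)%E) tape t.+1 q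
  | PCmp i j k => Config (k (compare_cells mem i j)) mem tape t.+1 q.+1
  end.

Definition run (R : realType) (A : Type) (c : computation A)
    (mem : seq (\bar R)) (tape : nat -> bool) (k : nat) : config R A :=
  iter k (@step R A) (Config c mem tape 0 0).

(* [c], started with protected cells [mem] and coin tosses [tape], terminates
   with result [a] and protected cells [mem'] after [t] operations, [q] of
   which are comparisons of protected cells. *)
Definition terminates (R : realType) (A : Type) (c : computation A)
    (mem : seq (\bar R)) (tape : nat -> bool)
    (a : A) (mem' : seq (\bar R)) (t q : nat) : Prop :=
  exists k tape', run c mem tape k = Config (Ret a) mem' tape' t q.

(** * The distance ordering problem and OPT_Q *)

(* The graph is unprotected input.  Vertices are output by their number. *)
Definition algorithm : Type := forall G : graph, computation (seq nat).

(* Initially the protected cells hold the constants 0 and +oo (used as keys by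
   Dijkstra's algorithm), followed by the weights. *)
Definition zero_cell : nat := 0%N.
Definition infty_cell : nat := 1%N.
Definition weight_cell (G : graph) (e : 'I_(ne G)) : nat := (2 + e)%N.

Definition init_cells (R : realType) (G : graph) (w : 'I_(ne G) -> R) :
    seq (\bar R) :=
  [:: 0%E, +oo%E & [seq (w e)%:E | e <- enum 'I_(ne G)]].

Definition valid_answer (R : realType) (G : graph) (w : 'I_(ne G) -> R)
    (out : seq nat) : Prop :=
  perm_eq out (iota 0 (nv G)) /\
  forall u v : 'I_(nv G), dist w u < dist w v ->
    (index (u : nat) out < index (v : nat) out)%N.

(* Under the uniform distribution on [0, 1] the binary digits of [x] are
   independent fair coin tosses. *)
Definition binary_digits (R : realType) (x : R) : nat -> bool :=
  fun k => odd (Num.truncn (x * 2 ^+ k.+1)).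

Definition coin_prob (R : realType) : probability (measurableTypeR R) R :=
  uniform_prob (@ltr01 R).

Definition correct (R : realType) (A : algorithm) : Prop :=
  forall (G : graph) (w : 'I_(ne G) -> R), positive w ->
    coin_prob R [set x | exists out mem t q,
      terminates (A G) (init_cells w) (binary_digits x) out mem t q /\
      valid_answer w out] = 1%E.

Definition total_queries (R : realType) (A : algorithm) (G : graph)
    (w : 'I_(ne G) -> R) (tape : nat -> bool) : \bar R :=
  ereal_sup (range (fun k : nat =>
    ((queries (run (A G) (init_cells w) tape k))%:R%:E : \bar R))).

Definition expected_queries (R : realType) (A : algorithm) (G : graph)
    (w : 'I_(ne G) -> R) : \bar R :=
  (\int[coin_prob R]_x total_queries A w (binary_digits x))%E.

Definition OPT_Q (R : realType) (G : graph) : \bar R :=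
  ereal_inf [set ereal_sup [set @expected_queries R A G w
                           | w in [set w | positive w]]
            | A in [set A | correct R A]].

(** * Priority queues *)

(* Elements are natural numbers; a key is (the address of) a protected cell. *)
Record pqueue := PQueue {
  pq_state : Type;
  pq_empty : pq_state;
  pq_insert : pq_state -> nat -> nat -> computation pq_state;
  pq_find_min : pq_state -> computation (pq_state * (nat * nat));
  pq_extract_min : pq_state -> computation (pq_state * (nat * nat));
  pq_decrease_key : pq_state -> nat -> nat -> computation pq_state }.

Arguments pq_empty : clear implicits.

Variant pq_event :=
| EvInsert of nat & nat
| EvFindMin
| EvExtract of nat
| EvDecrease of nat & nat.

(* A history [h : seq pq_event] lists the operations performed so far, oldest
   first. *)
Definition inserted (h : seq pq_event) : seq nat :=
  pmap (fun ev => if ev is EvInsert x _ then Some x else None) h.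

Definition extracted (h : seq pq_event) : seq nat :=
  pmap (fun ev => if ev is EvExtract x then Some x else None) h.

Definition present (h : seq pq_event) : seq nat :=
  [seq x <- inserted h | x \notin extracted h].

Definition update (A : Type) (f : nat -> A) (i : nat) (a : A) : nat -> A :=
  fun j => if j == i then a else f j.

Definition current_key (h : seq pq_event) : nat -> nat :=
  foldl (fun f ev => match ev with
                     | EvInsert x k | EvDecrease x k => update f x k
                     | _ => f
                     end) (fun=> 0%N) h.

Definition can_insert (R : realType) (h : seq pq_event) (mem : seq (\bar R))
    (x k : nat) : Prop :=
  x \notin inserted h /\ (k < size mem)%N.

Definition can_decrease (R : realType) (h : seq pq_event) (mem : seq (\bar R))
    (x k : nat) : Prop :=
  [/\ x \in present h, (k < size mem)%N
    & (cell mem k <= cell mem (current_key h x))%E].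

Definition is_min (R : realType) (h : seq pq_event) (mem : seq (\bar R))
    (x k : nat) : Prop :=
  [/\ x \in present h, cell mem k = cell mem (current_key h x)
    & forall y, y \in present h ->
        (cell mem (current_key h x) <= cell mem (current_key h y))%E].

(* [pq_run Q h mem q t]: starting from the empty queue, some legal sequence of
   operations with history [h] leads to state [q] and takes [t] steps
   altogether.  Between operations the user of the queue may create new
   protected cells; the operations themselves leave [mem] unchanged, i.e. they
   use no additions of protected cells. *)
Inductive pq_run (R : realType) (Q : pqueue) :
    seq pq_event -> seq (\bar R) -> pq_state Q -> nat -> Prop :=
| PQStart mem : pq_run [::] mem (pq_empty Q) 0
| PQNewCells h mem q t new :
    pq_run h mem q t -> pq_run h (mem ++ new) q t
| PQInsert h mem q t x k tape q' t' c :
    pq_run h mem q t -> can_insert h mem x k ->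
    terminates (pq_insert q x k) mem tape q' mem t' c ->
    pq_run (rcons h (EvInsert x k)) mem q' (t + t')%N
| PQFindMin h mem q t tape q' x k t' c :
    pq_run h mem q t -> present h != [::] ->
    terminates (pq_find_min q) mem tape (q', (x, k)) mem t' c ->
    pq_run (rcons h EvFindMin) mem q' (t + t')%N
| PQExtractMin h mem q t tape q' x k t' c :
    pq_run h mem q t -> present h != [::] ->
    terminates (pq_extract_min q) mem tape (q', (x, k)) mem t' c ->
    pq_run (rcons h (EvExtract x)) mem q' (t + t')%N
| PQDecreaseKey h mem q t x k tape q' t' c :
    pq_run h mem q t -> can_decrease h mem x k ->
    terminates (pq_decrease_key q x k) mem tape q' mem t' c ->
    pq_run (rcons h (EvDecrease x k)) mem q' (t + t')%N.

Definition is_priority_queue (R : realType) (Q : pqueue) : Prop :=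
  forall (h : seq pq_event) (mem : seq (\bar R)) (q : pq_state Q) (t : nat)
    (tape : nat -> bool), pq_run h mem q t ->
  [/\ forall x k, can_insert h mem x k -> exists q' t' c,
        terminates (pq_insert q x k) mem tape q' mem t' c,
      present h != [::] -> exists q' x k t' c,
        terminates (pq_find_min q) mem tape (q', (x, k)) mem t' c /\
        is_min h mem x k,
      present h != [::] -> exists q' x k t' c,
        terminates (pq_extract_min q) mem tape (q', (x, k)) mem t' c /\
        is_min h mem x k
    & forall x k, can_decrease h mem x k -> exists q' t' c,
        terminates (pq_decrease_key q x k) mem tape q' mem t' c].

(* W_{x,t}, where time [t] is the moment after the first [t] operations of [h];
   [x] is in the list itself as long as it is present. *)
Definition working_set_at (h : seq pq_event) (x t : nat) : seq nat :=
  [seq y <- present (take t h)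
  | (index x (inserted h) <= index y (inserted h))%N].

(* |W_x| for an element [x] about to be extracted after history [h].  Times
   before the insertion of [x] contribute the empty set. *)
Definition working_set_size (h : seq pq_event) (x : nat) : nat :=
  \max_(t < (size h).+1) size (working_set_at h x t).

Definition log2 (R : realType) (x : R) : R := ln x / ln 2.

Definition working_set_cost (R : realType) (h : seq pq_event) : R :=
  \sum_(i < size h)
    (if nth EvFindMin h i is EvExtract x
     then 1 + log2 (working_set_size (take i h) x)%:R else 1).

Definition fibonacci_like_working_set (R : realType) (Q : pqueue) : Prop :=
  is_priority_queue R Q /\
  exists c : R, forall (h : seq pq_event) (mem : seq (\bar R))
      (q : pq_state Q) (t : nat),
    pq_run h mem q t -> t%:R <= c * working_set_cost R h.

(** * Dijkstra's algorithm *)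

Definition read (A : Type) (f : nat -> A) (i : nat) : computation A :=
  Op (Ret (f i)).

Definition write (A : Type) (f : nat -> A) (i : nat) (a : A) :
    computation (nat -> A) :=
  Op (Ret (update f i a)).

Definition add (i j : nat) : computation nat := PAdd i j Ret.

Definition compare (i j : nat) : computation comparison := PCmp i j Ret.

(* The adjacency list of [u]: the other endpoint and the weight of every edge
   leaving [u] (directed case) or incident to [u] (undirected case). *)
Definition adjacency (G : graph) (u : nat) : seq (nat * nat) :=
  [seq (if edge_tail e == u :> nat then edge_head e : nat
        else edge_tail e : nat,
        weight_cell e)
  | e <- enum 'I_(ne G)
  & (edge_tail e == u :> nat) || ~~ directed G && (edge_head e == u :> nat)].

Record dijkstra_state (Q : pqueue) := DState {
  queue : pq_state Q;
  was_inserted : nat -> bool;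
  was_extracted : nat -> bool;
  dist_cell : nat -> nat;
  output : seq nat }.

Definition discover (Q : pqueue) (v : nat) (st : dijkstra_state Q) :
    computation (dijkstra_state Q) :=
  let: DState q ins ext D out := st in
  let! b := read ins v in
  if b then Ret st else
  let! q' := pq_insert q v infty_cell in
  let! ins' := write ins v true in
  Ret (DState q' ins' ext D out).

Definition relax (Q : pqueue) (du v we : nat) (st : dijkstra_state Q) :
    computation (dijkstra_state Q) :=
  let! b := read (was_extracted st) v in
  if b then Ret st else
  let! (DState q ins ext D out) := discover v st in
  let! x := add du we in
  let! dv := read D v in
  let! o := compare x dv in
  let dv' := if o is Lt then x else dv in
  let! D' := write D v dv' in
  let! q' := pq_decrease_key q v dv' in
  Ret (DState q' ins ext D' out).

(* One operation is charged for fetching each entry of the adjacency list. *)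
Fixpoint relax_all (Q : pqueue) (du : nat) (l : seq (nat * nat))
    (st : dijkstra_state Q) : computation (dijkstra_state Q) :=
  if l is (v, we) :: l' then
    Op (let! st' := relax du v we st in relax_all du l' st')
  else Ret st.

(* [k] is the number of vertices not yet extracted; the two [Op] are the test
   of the loop condition and the write to the output. *)
Fixpoint dijkstra_loop (Q : pqueue) (G : graph) (k : nat)
    (st : dijkstra_state Q) : computation (seq nat) :=
  if k is k'.+1 then
    let: DState q ins ext D out := st in
    Op (let! (q', (u, du)) := pq_extract_min q in
        let! ext' := write ext u true in
        Op (let! st' := relax_all du (adjacency G u)
                          (DState q' ins ext' D (rcons out u)) in
            dijkstra_loop G k' st'))
  else Op (Ret (output st)).

(* The initialization of the three arrays is charged [3 * nv G] operations. *)
Definition dijkstra (Q : pqueue) : algorithm := fun G =>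
  iter (3 * nv G) Op
    (let! q := pq_insert (pq_empty Q) (src G) zero_cell in
     let! ins := write (fun=> false) (src G) true in
     let! D := write (fun=> infty_cell) (src G) zero_cell in
     dijkstra_loop G (nv G) (DState q ins (fun=> false) D [::])).

(* Main.v *)
Require Import Defs.
From mathcomp Require Import all_boot all_order all_algebra.
From mathcomp Require Import all_classical all_reals all_analysis.
From mathcomp Require Import measurable_realfun zify lra.
Import Order.TTheory GRing.Theory Num.Theory.
Local Open Scope ring_scope.

(** Let [ins v] be the number of vertices inserted before [v] during the run of
    Dijkstra's algorithm and [ext v] the number inserted before the extraction
    of [v], so that [|W_v| <= ext v - ins v].  The vertex [u] whose scan
    discovers [v] satisfies [ext u <= ins v].  Hence for every choice of
    integers [ins v <= r v < ext v] the potential [r v * n + ins v] increases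
    from [u] to [v], and giving every edge the absolute difference of the
    potentials of its endpoints produces weights whose distances are these
    potentials.  A valid answer lists the vertices by nondecreasing [r], so it
    serves at most [4 ^ n] choices.  A ternary decision tree therefore needs
    [log_3 (prod (ext v - ins v) / 4 ^ n)] comparisons on average over the
    choices, for almost every outcome of the coin tosses, which bounds
    [sum (log2 |W_v|)] by [O(OPT_Q + n)].  For the number of queries, the
    potential given by the order of extraction yields weights for which every
    edge relaxed by the algorithm is forward. *)

(** * Big-step semantics and a counting bound for ternary decision trees *)

Section Evaluation.
Set Implicit Arguments.
Unset Strict Implicit.
Unset Printing Implicit Defensive.
Variable R : realType.

(* Big-step form of [terminates], also recording the unused coin tosses. *)
Inductive evals (A : Type) : computation A -> seq (\bar R) -> (nat -> bool) ->
    A -> seq (\bar R) -> (nat -> bool) -> nat -> nat -> Prop :=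
| EvalRet a mem tape : evals (Ret a) mem tape a mem tape 0 0
| EvalOp c mem tape a mem' tape' t q :
    evals c mem tape a mem' tape' t q ->
    evals (Op c) mem tape a mem' tape' t.+1 q
| EvalFlip k mem tape a mem' tape' t q :
    evals (k (tape 0%N)) mem (fun i => tape i.+1) a mem' tape' t q ->
    evals (Flip k) mem tape a mem' tape' t.+1 q
| EvalPAdd i j k mem tape a mem' tape' t q :
    evals (k (size mem)) (rcons mem (cell mem i + cell mem j)%E) tape
      a mem' tape' t q ->
    evals (PAdd i j k) mem tape a mem' tape' t.+1 q
| EvalPCmp i j k mem tape a mem' tape' t q :
    evals (k (compare_cells mem i j)) mem tape a mem' tape' t q ->
    evals (PCmp i j k) mem tape a mem' tape' t.+1 q.+1.

Lemma evals_inv (A : Type) (c : computation A) mem tape a mem' tape' t q :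
  evals c mem tape a mem' tape' t q ->
  match c with
  | Ret b => [/\ b = a, mem' = mem, tape' = tape, t = 0%N & q = 0%N]
  | Op c' => exists2 t', t = t'.+1 & evals c' mem tape a mem' tape' t' q
  | Flip k => exists2 t', t = t'.+1 &
      evals (k (tape 0%N)) mem (fun i => tape i.+1) a mem' tape' t' q
  | PAdd i j k => exists2 t', t = t'.+1 &
      evals (k (size mem)) (rcons mem (cell mem i + cell mem j)%E) tape
        a mem' tape' t' q
  | PCmp i j k => exists t' q', [/\ t = t'.+1, q = q'.+1 &
      evals (k (compare_cells mem i j)) mem tape a mem' tape' t' q']
  end.
Proof. by case=> *; do ?[split | eexists]; eassumption. Qed.

(** Every rule except [EvalRet] is one machine step, so the time is also the number of steps; the
    offsets [t0] and [q0] carry the induction. *)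
Lemma evals_steps (A : Type) (c : computation A) mem tape a mem' tape' t q :
  evals c mem tape a mem' tape' t q -> forall t0 q0,
  iter t (@step R A) (Config c mem tape t0 q0) =
    Config (Ret a) mem' tape' (t0 + t) (q0 + q).
Proof.
elim=> {c mem tape a mem' tape' t q}
  [a mem tape|c mem tape a mem' tape' t q _ IH|k mem tape a mem' tape' t q _ IH
  |i j k mem tape a mem' tape' t q _ IH|i j k mem tape a mem' tape' t q _ IH]
  t0 q0; rewrite ?iterSr /= ?IH ?addn0 ?addSn ?addnS //.
Qed.

(** [k] may exceed the running time because [step] leaves a returned configuration fixed. *)
Lemma steps_evals (A : Type) k (c : computation A) mem tape a mem' tape' t0 q0
    t q :
  iter k (@step R A) (Config c mem tape t0 q0) = Config (Ret a) mem' tape' t q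
    ->
  exists t' q', [/\ t = (t0 + t')%N, q = (q0 + q')%N
    & evals c mem tape a mem' tape' t' q'].
Proof.
elim: k c mem tape t0 q0 => [|k IH] c mem tape t0 q0.
  by case=> -> -> -> -> ->; exists 0%N, 0%N; rewrite !addn0; split=> //;
     constructor.
rewrite iterSr; case: c => [b|c|f|i j f|i j f] /= /IH[t' [q' [-> ->]]] ev.
- by exists t', q'.
- by exists t'.+1, q'; rewrite addSnnS; split=> //; constructor.
- by exists t'.+1, q'; rewrite addSnnS; split=> //; constructor.
- by exists t'.+1, q'; rewrite addSnnS; split=> //; constructor.
- by exists t'.+1, q'.+1; rewrite !addSnnS; split=> //; constructor.
Qed.

Lemma terminatesP (A : Type) (c : computation A) mem tape a mem' t q :
  terminates c mem tape a mem' t q <->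
  exists tape', evals c mem tape a mem' tape' t q.
Proof.
split=> [[k [tape' E]]|[tape' ev]].
  by have [t' [q' [-> -> ev]]] := steps_evals E; exists tape'.
by exists t, tape'; rewrite /run (evals_steps ev).
Qed.

(** Lets the comparisons made inside a queue operation be charged to its time. *)
Lemma evals_queries_le_time (A : Type) (c : computation A) mem tape a mem'
    tape' t q :
  evals c mem tape a mem' tape' t q -> (q <= t)%N.
Proof. by elim=> // *; apply: ltnW. Qed.

(** A cofixpoint unfolds only under a match; the identity [unfold] supplies one. *)
Lemma bindE (A B : Type) (c : computation A) (f : A -> computation B) :
  bind c f = match c with
             | Ret a => f a
             | Op c' => Op (bind c' f)
             | Flip k => Flip (fun b => bind (k b) f)
             | PAdd i j k => PAdd i j (fun x => bind (k x) f)
             | PCmp i j k => PCmp i j (fun x => bind (k x) f)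
             end.
Proof.
pose unfold (c : computation B) := match c with
  | Ret a => Ret a | Op c' => Op c' | Flip k => Flip k
  | PAdd i j k => PAdd i j k | PCmp i j k => PCmp i j k end.
have unfoldE c' : unfold c' = c' by case: c'.
by rewrite -[LHS]unfoldE; case: c => // a; exact: (unfoldE (f a)).
Qed.

Lemma evals_bind (A B : Type) (c : computation A) (f : A -> computation B)
    mem tape a mem1 tape1 t1 q1 b mem2 tape2 t2 q2 :
  evals c mem tape a mem1 tape1 t1 q1 ->
  evals (f a) mem1 tape1 b mem2 tape2 t2 q2 ->
  evals (bind c f) mem tape b mem2 tape2 (t1 + t2) (q1 + q2).
Proof.
elim=> {c mem tape a mem1 tape1 t1 q1} [a mem tape|c mem tape a mem' tape' t q _
  IH|k mem tape a mem' tape' t q _ IH|i j k mem tape a mem' tape' t q _ IH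
  |i j k mem tape a mem' tape' t q _ IH] evf; rewrite bindE ?addSn //.
all: by constructor; apply: IH.
Qed.

Lemma evals_iter_op (A : Type) n (c : computation A) mem tape a mem' tape' t q :
  evals c mem tape a mem' tape' t q ->
  evals (iter n Op c) mem tape a mem' tape' (n + t) q.
Proof. by move=> ev; elim: n => //= n IH; rewrite addSn; constructor. Qed.

(* Kraft's inequality for a ternary decision tree each of whose answers serves
   at most [K] of the inputs in [S]. *)
Lemma kraft (A : eqType) (I : finType) (K k : nat) (c : computation A)
    (mem : I -> seq (\bar R)) (tape : nat -> bool) (sz : nat) (S : {set I})
    (out : I -> A) (q : I -> nat) :
  (forall i, i \in S -> size (mem i) = sz) ->
  (forall i, i \in S -> exists mem' tape' t,
     (t <= k)%N /\ evals c (mem i) tape (out i) mem' tape' t (q i)) ->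
  (forall a, #|[set i in S | out i == a]| <= K)%N ->
  \sum_(i in S) (3 : R) ^- q i <= K%:R.
Proof.
elim: k c mem tape sz S q => [|k IH] c mem tape sz S q szS ev leK.
  have [->|[i0 i0S]] := set_0Vmem S; first by rewrite big_set0 ler0n.
  (* With no step left the program has already returned, so all inputs receive one common answer
     without queries and [leK] bounds their number. *)
  have answer i : i \in S -> exists2 b, c = Ret b & b = out i /\ q i = 0%N.
    move=> /ev[mi [ti [t []]]]; rewrite leqn0 => /eqP -> evi.
    have := evals_inv evi;
      case: {ev evi} c => [b [-> _ _ _ ->]|c' []|f []|l j f []|l j f [t' [q'
      []]]] //.
    by exists (out i).
  have q0 i : i \in S -> q i = 0%N /\ out i = out i0.
    move=> /answer[b cb [<- ->]]; have [b0] := answer _ i0S.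
    by rewrite cb => -[->] [<-].
  rewrite (eq_bigr (fun=> 1)) => [|i /q0[-> _]]; last by rewrite expr0 invr1.
  rewrite sumr_const ler_nat; apply: leq_trans (leK (out i0)).
  by apply/subset_leq_card/fintype.subsetP => i iS;
    rewrite inE iS (q0 i iS).2 /=.
case: c ev => [b|c|f|i j f|i j f] ev.
- apply: (IH (Ret b) mem tape sz) => // i /ev[mi [ti [t [_ evi]]]].
  have := evals_inv evi.
  by case=> -> _ _ _ ->; exists (mem i), tape, 0%N; split=> //; constructor.
- apply: (IH c mem tape sz) => // i /ev[mi [ti [t [letk ev1]]]].
  have [t0 et evi] := evals_inv ev1.
  by exists mi, ti, t0; rewrite et in letk.
- apply: (IH (f (tape 0%N)) mem (fun i => tape i.+1) sz) => //.
  move=> i /ev[mi [ti [t [letk ev1]]]].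
  have [t0 et evi] := evals_inv ev1.
  by exists mi, ti, t0; rewrite et in letk.
(* All memories have the same size, so the new cell has the same address on every input and the
   continuation is common. *)
- apply: (IH (f sz) (fun l => rcons (mem l) (cell (mem l) i + cell (mem l) j)%E)
     tape sz.+1) => // l lS.
    by rewrite size_rcons szS.
  have [mi [ti [t [letk ev1]]]] := ev l lS.
  have [t0 et evi] := evals_inv ev1.
  by exists mi, ti, t0; rewrite -(szS l lS); rewrite et in letk.
(* The inputs are split by the outcome of the comparison; each branch has one query less to make, so
   it contributes at most a third of [K]. *)
- pose S' o := [set l in S | match compare_cells (mem l) i j, o with
    | Lt, Lt | Eq, Eq | Gt, Gt => true | _, _ => false end].
  have S'E o l : l \in S' o -> l \in S /\ compare_cells (mem l) i j = o.
    by rewrite inE => /andP[]; case: (compare_cells _ _ _) o => [] [].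
  have key o : \sum_(l in S' o) (3 : R) ^- (q l) <= K%:R / 3.
    rewrite (eq_bigr (fun l => 3 ^- (q l).-1 * 3^-1)) => [|l /S'E[lS _]].
      rewrite -mulr_suml ler_pM2r ?invr_gt0 //.
      apply: (IH (f o) mem tape sz).
      - by move=> l /S'E[lS _]; apply: szS.
      - move=> l /S'E[lS lo]; have [mi [ti [t [letk ev1]]]] := ev l lS.
        by have [t0 [q0 [et -> evi]]] := evals_inv ev1; exists mi, ti, t0;
          rewrite -lo; rewrite et in letk.
      - move=> a; apply: leq_trans (leK a);
          apply/subset_leq_card/fintype.subsetP => l.
        by rewrite inE => /andP[/S'E[lS _] la]; rewrite inE lS.
    have [mi [ti [t [letk ev1]]]] := ev l lS.
    have [t0 [q0 [_ -> _]]] := evals_inv ev1.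
    by rewrite /= exprS invfM mulrC.
  have -> : \sum_(l in S) (3 : R) ^- q l = \sum_(l in S' Lt) (3 : R) ^- q l +
     \sum_(l in S' Eq) (3 : R) ^- q l + \sum_(l in S' Gt) (3 : R) ^- q l.
    rewrite big_mkcond [X in _ = X + _ + _]big_mkcond [X in _ = _ + X +
      _]big_mkcond.
    rewrite [X in _ = _ + X]big_mkcond -!big_split /=; apply: eq_bigr => l _.
    rewrite !inE; case: (l \in S) => //=; last by rewrite !addr0.
    by case: (compare_cells _ _ _); rewrite ?addr0 ?add0r.
  by have := key Lt; have := key Eq; have := key Gt; lra.
Qed.

(* Averaging Kraft's inequality, using [1 + x <= expR x] as Jensen's
   inequality. *)
Lemma sum_queries_ge (I : finType) (S : {set I}) (q : I -> nat) (K : R) :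
  (0 < #|S|)%N -> 0 < K ->
  \sum_(i in S) (3 : R) ^- q i <= K ->
  #|S|%:R * ln (#|S|%:R / K) <= ln 3 * \sum_(i in S) (q i)%:R.
Proof.
move=> S0 K0 kr; set M : R := #|S|%:R; have M0 : 0 < M by rewrite ltr0n.
have MK0 : 0 < M / K by rewrite divr_gt0.
(* The exponential of [ln (M / K) - (q i)%:R * ln 3] is [M / K * 3 ^- q i], and these sum to at most
   [M]. *)
have key : \sum_(i in S) (1 + (ln (M / K) - (q i)%:R * ln 3)) <= M.
  apply: (@le_trans _ _ (M / K * \sum_(i in S) 3 ^- q i)).
    rewrite mulr_sumr; apply: ler_sum => i _.
    apply: le_trans (expR_ge1Dx _) _.
    by rewrite expRB lnK ?posrE // expRM_natl lnK ?posrE.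
  rewrite -[leRHS](divfK (lt0r_neq0 K0)).
  by rewrite ler_pM2l.
move: key; rewrite big_split /= sumr_const sumrB -mulr_suml sumr_const.
rewrite -[_ *+ _ in X in _ + (X - _) <= _]mulr_natl -/M.
by rewrite [ln 3 * _]mulrC; lra.
Qed.

End Evaluation.

(** * Edge weights that realize an integer potential as distances *)

Section Potentials.
Set Implicit Arguments.
Unset Strict Implicit.
Unset Printing Implicit Defensive.
Local Open Scope classical_set_scope.
Variables (R : realType) (G : graph).
Implicit Types (D : 'I_(nv G) -> nat) (e : 'I_(ne G)) (u v : 'I_(nv G)).

(** A local condition that yields, by descent, a walk of increasing potential from the source to
    every vertex. *)
Definition has_parents D : Prop :=
  forall v, v != src G -> exists e u, traverses e u v /\ (D u < D v)%N.

(** The value 1 on ties keeps weights positive and still dominates the potential difference, which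
    is 0 there. *)
Definition potential_weight D e : R :=
  if D (edge_tail e) == D (edge_head e) then 1
  else `|(D (edge_tail e))%:R - (D (edge_head e))%:R|.

Lemma potential_weight_gt0 D : positive (potential_weight D).
Proof.
move=> e; rewrite /potential_weight; case: eqVneq => [//|Dne].
by rewrite normr_gt0 subr_eq0 eqr_nat.
Qed.

Lemma potential_weight_ge D e u v :
  traverses e u v -> (D v)%:R - (D u)%:R <= potential_weight D e.
Proof.
rewrite /potential_weight.
case/orP=> [/andP[/eqP <- /eqP <-]|/andP[/andP[_ /eqP <-] /eqP <-]].
  by case: eqVneq => [->|_]; rewrite ?subrr // distrC ler_norm.
by case: eqVneq => [->|_]; rewrite ?subrr // ler_norm.
Qed.

Lemma potential_weightE D e u v : traverses e u v -> (D u < D v)%N ->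
  potential_weight D e = (D v)%:R - (D u)%:R.
Proof.
move=> + uv; rewrite /potential_weight.
have uv0 : 0 <= (D v)%:R - (D u)%:R :> R by rewrite subr_ge0 ler_nat ltnW.
case/orP=> [/andP[/eqP -> /eqP ->]|/andP[/andP[_ /eqP ->] /eqP ->]].
  by rewrite ltn_eqF // distrC ger0_norm.
by rewrite gtn_eqF // ger0_norm.
Qed.

Lemma walk_rcons u p v e x :
  walk u p v -> traverses e v x -> walk u (rcons p e) x.
Proof.
elim: p u => [|f p IH] u /=.
  by move=> /eqP -> evx; apply/existsP; exists x; rewrite evx eqxx.
move=> /existsP[y /andP[fy yp]] evx.
by apply/existsP; exists y; rewrite fy IH.
Qed.

Lemma walk_potential_ge D u p v : walk u p v ->
  (D v)%:R - (D u)%:R <= \sum_(e <- p) potential_weight D e.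
Proof.
elim: p u => [|f p IH] u /=; first by move=> /eqP ->; rewrite subrr big_nil.
move=> /existsP[y /andP[fy /IH]]; rewrite big_cons.
by have := potential_weight_ge D fy; lra.
Qed.

(** Parents are followed down to the source by strong induction on [D v]; along this walk the
    weights telescope with equality. *)
Lemma walk_potential_eq D : has_parents D -> forall v, exists2 p,
  walk (src G) p v &
  \sum_(e <- p) potential_weight D e = (D v)%:R - (D (src G))%:R.
Proof.
move=> parD v; have [n] := ubnP (D v); elim: n v => // n IH v vn.
have [->|/parD[e [u [euv uv]]]] := eqVneq v (src G).
  by exists [::]; rewrite ?big_nil ?subrr /=.
have [|p sp sump] := IH u; first by apply: leq_trans uv vn.
exists (rcons p e); first exact: walk_rcons sp euv.
by rewrite big_rcons /= sump (potential_weightE euv uv); lra.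
Qed.

(** The telescoping lower bound holds for every walk, and the walk through parents attains it. *)
Lemma dist_potential D v : has_parents D ->
  dist (potential_weight D) v = (D v)%:R - (D (src G))%:R.
Proof.
move=> parD; have [p sp sump] := walk_potential_eq parD v.
have lb : lbound [set \sum_(e <- p) potential_weight D e
    | p in [set p | walk (src G) p v]] ((D v)%:R - (D (src G))%:R).
  by move=> _ [p' sp' <-]; exact: walk_potential_ge.
apply/eqP; rewrite eq_le; apply/andP; split.
  by rewrite -sump; apply: ge_inf;
    [exists ((D v)%:R - (D (src G))%:R)|exists p].
by apply: lb_le_inf => //; exists (\sum_(e <- p) potential_weight D e);
  exists p.
Qed.

Lemma forward_potential D : has_parents D ->
  forward_edges (potential_weight D) =
  (if directed G then [set e | (D (edge_tail e) < D (edge_head e))%N]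
   else [set e | D (edge_tail e) != D (edge_head e)])%SET.
Proof.
move=> parD; rewrite /forward_edges; case: ifP => _; apply/setP => e.
  by rewrite !inE !dist_potential // ltrD2r ltr_nat.
by rewrite !inE !dist_potential // (can_eq (subrK _)) eqr_nat.
Qed.

Lemma card_forward_le (w : 'I_(ne G) -> R) :
  positive w -> (#|forward_edges w| <= max_forward R G)%N.
Proof.
move=> w0; have ltF : (#|forward_edges w| < (ne G).+1)%N.
  by rewrite ltnS -[X in (_ <= X)%N]card_ord max_card.
apply: (@leq_bigmax_cond _ _ _ (Ordinal ltF)).
by apply/asboolP; exists w.
Qed.

End Potentials.

(** * Measurability and averaging over a finite family of inputs *)

Section LowerBound.
Set Implicit Arguments.
Unset Strict Implicit.
Unset Printing Implicit Defensive.
Local Open Scope classical_set_scope.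
Variable R : realType.

(** One step reads at most one coin, so [k] steps cannot distinguish tapes that agree on the first
    [k] tosses. *)
Lemma run_prefix (A : Type) (k : nat) (c : computation A) (mem : seq (\bar R))
    (tape tape' : nat -> bool) (t q : nat) :
  (forall i, (i < k)%N -> tape i = tape' i) ->
  let s := iter k (@step R A) (Config c mem tape t q) in
  let s' := iter k (@step R A) (Config c mem tape' t q) in
  Defs.code s = Defs.code s' /\ queries s = queries s'.
Proof.
elim: k c mem tape tape' t q => [//|k IH] c mem tape tape' t q eqt.
have eqk i : (i < k)%N -> tape i = tape' i.
  by move=> ik; apply: eqt; exact: ltnW.
rewrite !iterSr; case: c => [a|c|f|i j f|i j f] /=; try exact: IH.
by rewrite (eqt 0%N) //; apply: IH => i ik; apply: eqt.
Qed.

(** The digit is 1 exactly on a countable union of half-open dyadic intervals whose left numerator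
    is odd. *)
Lemma measurable_digit (k : nat) (b : bool) :
  measurable ([set x | binary_digits x k = b] : set (measurableTypeR R)).
Proof.
have m1 : measurable ([set x | binary_digits x k] : set (measurableTypeR R)).
  rewrite [X in measurable X](_ : _ = \bigcup_(m in [set m | odd m])
    `[m%:R / 2 ^+ k.+1, m.+1%:R / 2 ^+ k.+1 [ ); last first.
    have p0 : 0 < 2 ^+ k.+1 :> R by rewrite exprn_gt0.
    rewrite /binary_digits; apply/seteqP; split=> x /=.
      move=> oddx; exists (Num.truncn (x * 2 ^+ k.+1)) => //=.
      rewrite in_itv /= ler_pdivrMr // ltr_pdivlMr //.
      (* A negative [x] truncates to 0, which is even. *)
      apply: truncn_itv; rewrite leNgt; apply/negP => x0.
      by move: (odd_gt0 oddx); rewrite truncn_gt0 leNgt (lt_trans x0 ltr01).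
    move=> [m /= oddm]; rewrite in_itv /= ler_pdivrMr // ltr_pdivlMr // => xm.
    by rewrite (truncn_def xm).
  by apply: bigcup_measurable => m _; apply: measurable_itv.
case: b; first exact: m1.
rewrite [X in measurable X](_ : _ = ~` [set x | binary_digits x k]).
  exact: measurableC.
by apply/seteqP; split=> x /=; case: binary_digits.
Qed.

(** The event is a finite union, over the accepted prefixes of length [k], of finite intersections
    of digit events. *)
Lemma measurable_prefix (k : nat) (P : (nat -> bool) -> Prop) :
  (forall tape tape', (forall i, (i < k)%N -> tape i = tape' i) ->
     P tape -> P tape') ->
  measurable ([set x | P (binary_digits x)] : set (measurableTypeR R)).
Proof.
move=> detP; rewrite [X in measurable X](_ : _ =
  \big[setU/set0]_(b <- enum {: k.-tuple bool} | `[< P (nth false b) >])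
  \big[setI/setT]_(i <- iota 0 k)
    [set x | binary_digits x i = nth false b i]).
  apply: bigsetU_measurable => b _; apply: bigsetI_measurable => i _.
  exact: measurable_digit.
apply/seteqP; split=> x /=.
  move=> Px; pose b := [tuple binary_digits x i | i < k].
  have bE i : (i < k)%N -> binary_digits x i = nth false b i.
    by move=> ik; rewrite -[i]/(val (Ordinal ik)) -tnth_nth tnth_mktuple.
  rewrite -bigcup_seq_cond; exists b => /=.
    rewrite mem_enum; apply/andP; split=> //; apply/asboolP; exact: detP Px.
  rewrite -bigcap_seq => i /=; rewrite mem_iota => /andP[_ ik].
  exact: bE.
rewrite -bigcup_seq_cond => -[b /= /andP[_ /asboolP Pb]].
rewrite -bigcap_seq => bx; apply: detP Pb => i ik; symmetry; apply: bx => /=.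
by rewrite mem_iota.
Qed.

Lemma measurable_total_queries (A : algorithm) (G : graph)
    (w : 'I_(ne G) -> R) :
  measurable_fun setT (fun x : measurableTypeR R =>
    total_queries A w (binary_digits x)).
Proof.
pose f (k : nat) (x : measurableTypeR R) : \bar R :=
  (queries (run (A G) (init_cells w) (binary_digits x) k))%:R%:E.
have mf k : measurable_fun setT (f k).
  move=> _ Y _; rewrite setTI.
  apply: (@measurable_prefix k (fun tape =>
    Y (queries (run (A G) (init_cells w) tape k))%:R%:E)) => tape tape' eqt.
  by rewrite /run (run_prefix _ _ _ _ eqt).2.
have := measurable_fun_esups mf 0%N.
apply: eq_measurable_fun => x _; rewrite /esups /total_queries /=.
by congr ereal_sup; apply/seteqP; split=> y /= [k _ <-]; exists k.
Qed.

Lemma total_queries_ge0 (A : algorithm) (G : graph) (w : 'I_(ne G) -> R) tape :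
  (0 <= total_queries A w tape)%E.
Proof.
apply: (@le_trans _ _ ((queries (run (A G) (init_cells w) tape 0))%:R%:E)).
  by rewrite lee_fin ler0n.
by apply: ereal_sup_ubound; exists 0%N.
Qed.

Lemma total_queries_ge (A : algorithm) (G : graph) (w : 'I_(ne G) -> R) tape
    out mem tape' t q :
  evals (A G) (init_cells w) tape out mem tape' t q ->
  (q%:R%:E <= total_queries A w tape)%E.
Proof.
move=> ev; apply: ereal_sup_ubound; exists t => //.
by rewrite /run (evals_steps ev).
Qed.

(** Termination with a valid answer is a union over [k] of events decided by [k] coins, hence
    measurable; probability 1 then makes its complement null. *)
Lemma correct_ae (A : algorithm) (G : graph) (w : 'I_(ne G) -> R) :
  correct R A -> positive w ->
  \forall x \ae coin_prob R, exists out mem t q,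
    terminates (A G) (init_cells w) (binary_digits x) out mem t q /\
    valid_answer w out.
Proof.
move=> cA w0; set Good := (X in \forall x \ae _, X x).
have mGood : measurable (Good : set (measurableTypeR R)).
  rewrite [X in measurable X](_ : _ = \bigcup_k [set x | exists2 out,
     Defs.code (run (A G) (init_cells w) (binary_digits x) k) = Ret out
     & valid_answer w out]); last first.
    apply/seteqP; split=> x.
      move=> [out [mem [t [q [[k [tape' rk]] va]]]]]; exists k => //=.
      by exists out; rewrite ?rk.
    move=> [k _ [out]]; case E: run => [c mem tape t q] /= cE va.
    by exists out, mem, t, q; split=> //; exists k, tape; rewrite E cE.
  apply: bigcup_measurable => k _; apply: (@measurable_prefix k (fun tape =>
    exists2 out, Defs.code (run (A G) (init_cells w) tape k) = Ret out
    & valid_answer w out)) => tape tape' eqt [out cE va].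
  by exists out => //; rewrite /run -(run_prefix _ _ _ _ eqt).1.
exists (~` Good); split=> //; first exact: measurableC.
by rewrite probability_setC // cA // subee.
Qed.

(** Yao's averaging argument: fix the coin tosses, apply the decision-tree bound to the family [w],
    integrate over the tosses, and bound each expectation by the supremum. *)
Lemma sup_expected_queries_ge (A : algorithm) (G : graph) (I : finType)
    (S : {set I}) (w : I -> 'I_(ne G) -> R) (K : nat) :
  correct R A -> (forall i, positive (w i)) -> (0 < #|S|)%N -> (0 < K)%N ->
  (forall out, #|[set i in S | `[< valid_answer (w i) out >]]%SET| <= K)%N ->
  ((ln (#|S|%:R / K%:R) / ln 3)%:E <=
    ereal_sup [set @expected_queries R A G w | w in [set w | positive w]])%E.
Proof.
move=> cA w0 S0 K0 leK; set L := ln _ / ln 3; set B := ereal_sup _.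
have E_le i : (expected_queries A (w i) <= B)%E.
  by apply: ereal_sup_ubound; exists (w i) => //; apply: w0.
have [i0 i0S] : exists i0, i0 \in S.
  by apply/set0Pn; rewrite -card_gt0.
have B0 : (0 <= B)%E.
  apply: le_trans (E_le i0); apply: integral_ge0 => x _.
  exact: total_queries_ge0.
have [L0|L0] := ltP L 0; first by apply: le_trans B0; rewrite lee_fin ltW.
have ln30 : 0 < ln 3 :> R by rewrite ln_gt0 // ltr1n.
have key : \forall x \ae coin_prob R, setT x -> ((#|S|%:R * L)%:E <=
    \sum_(i <- enum S) total_queries A (w i) (binary_digits x))%E.
  (* Finitely many almost sure events hold simultaneously, so almost every outcome of the coins is
     good for all inputs at once. *)
  have : \forall x \ae coin_prob R, forall i, exists out mem t q,
    terminates (A G) (init_cells (w i)) (binary_digits x) out mem t q /\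
    valid_answer (w i) out.
    apply: (@filter_forall _ _ _ _ (ae_filter_ringOfSetsType (coin_prob R))).
    by move=> i; exact: correct_ae.
  apply: (@filterS _ _ (ae_filter_ringOfSetsType (coin_prob R))) => x good _.
  have /choice[f fP] : forall i, exists y : seq nat * nat * nat,
      (exists mem tape', evals (A G) (init_cells (w i)) (binary_digits x)
         y.1.1 mem tape' y.1.2 y.2) /\ valid_answer (w i) y.1.1.
    move=> i; have [out [mem [t [q [/terminatesP[tape' ev] va]]]]] := good i.
    by exists (out, t, q); split=> //; exists mem, tape'.
  apply: (@le_trans _ _ (\sum_(i <- enum S) (f i).2%:R%:E)%E); last first.
    apply: lee_sum => i _; have [[mem [tape' ev]] _] := fP i.
    exact: total_queries_ge ev.
  rewrite sumEFin lee_fin big_enum /=.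
  have kr : \sum_(i in S) (3 : R) ^- (f i).2 <= K%:R.
    (* The depth of the tree is the largest running time over the family; [(ne G).+2] counts the two
       constant cells and the weights. *)
    apply: (@kraft R _ I K (\max_i (f i).1.2) (A G) (fun i => init_cells (w i))
      (binary_digits x) (ne G).+2 S (fun i => (f i).1.1)).
    - by move=> i _; rewrite /= size_map size_enum_ord.
    - move=> i _; have [[mem [tape' ev]] _] := fP i.
      by exists mem, tape', (f i).1.2; split=> //; apply: (leq_bigmax i).
    - move=> a; apply: leq_trans (leK a); apply: subset_leq_card.
      apply/fintype.subsetP => i; rewrite !inE => /andP[-> /eqP <-] /=.
      by apply/asboolP; exact: (fP i).2.
  have := sum_queries_ge S0 _ kr; rewrite ltr0n => /(_ K0).
  by rewrite mulrA ler_pdivrMr // mulrC [X in _ <= X]mulrC.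
have : ((#|S|%:R * L)%:E <= \sum_(i <- enum S) expected_queries A (w i))%E.
  rewrite -ge0_integral_sum //; last first.
  - by move=> i x _; exact: total_queries_ge0.
  - by move=> i; exact: measurable_total_queries.
  have <- : (\int[coin_prob R]_x cst (#|S|%:R * L)%:E x = (#|S|%:R * L)%:E)%E.
    rewrite integral_cst // -[RHS]mule1; congr (_ * _)%E.
    exact: probability_setT.
  apply: ae_ge0_le_integral => //.
  - by move=> x _; rewrite /= lee_fin mulr_ge0.
  - by move=> x _; apply: sume_ge0 => i _; exact: total_queries_ge0.
  - by apply: emeasurable_sum => i; exact: measurable_total_queries.
have : (\sum_(i <- enum S) expected_queries A (w i) <=
        \sum_(i <- enum S) B)%E by apply: lee_sum.
move=> /[swap] /le_trans /[apply].
(* An infinite supremum is immediate; otherwise the bound follows on dividing by [#|S|]. *)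
case: B {E_le} B0 => [b b0|_ _|//]; last by rewrite leey.
rewrite sumEFin big_enum sumr_const -[b *+ _]mulr_natl !lee_fin ler_pM2l //.
by rewrite ltr0n.
Qed.

End LowerBound.

(** * Lower bound on [OPT_Q] from a family of intervals *)

Section Intervals.
Set Implicit Arguments.
Unset Strict Implicit.
Unset Printing Implicit Defensive.

Lemma bin_le_exp2 n k : ('C(n, k) <= 2 ^ n)%N.
Proof.
rewrite -[n in 'C(n, _)]card_ord -card_draws -[n in (2 ^ n)%N]card_ord.
by rewrite -cardsT -card_powerset subset_leq_card // powersetT finset.subsetT.
Qed.

(** For positive [n] there are ['C(2 * n - 1, n)] nondecreasing sequences, and a binomial
    coefficient is at most the number of all subsets. *)
Lemma card_sorted_tuples_le n :
  (#|[set t : n.-tuple 'I_n | sorted leq [seq val i | i <- t]]| <= 4 ^ n)%N.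
Proof.
case: n => [|n]; first by apply: leq_trans (max_card _) _; rewrite card_tuple.
rewrite card_sorted_tuples; apply: leq_trans (bin_le_exp2 _ _) _.
rewrite -[4%N]/(2 ^ 2)%N -expnM leq_exp2l //; lia.
Qed.

Lemma card_ord_itv n a b : (b <= n)%N ->
  #|[pred j : 'I_n | (a <= j < b)%N]| = (b - a)%N.
Proof.
move=> bn; rewrite -sum1_card.
rewrite -(big_mkord (fun j => (a <= j < b)%N) (fun=> 1%N)) /=.
rewrite -(big_nat_widen 0 b n (fun j => (a <= j)%N)) //.
by rewrite -[RHS]muln1 -sum_nat_const_nat (big_nat_widenl a 0).
Qed.

Variables (R : realType) (G : graph) (ins ext : 'I_(nv G) -> nat).
Hypothesis ins_lt_ext : forall v, (ins v < ext v)%N.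
Hypothesis ext_le : forall v, (ext v <= nv G)%N.
Hypothesis parent_before : forall v, v != src G ->
  exists e u, traverses e u v /\ (ext u <= ins v)%N.

Notation choices := {ffun 'I_(nv G) -> 'I_(nv G)}.

Definition interval_choices : {set choices} :=
  [set r in family (fun v => [pred j : 'I_(nv G) | (ins v <= j < ext v)%N])].

(** Encodes the pair of [r v] and [ins v] in base [nv G]; since [ins v < nv G], a larger [r] means a
    larger potential. *)
Definition choice_potential (r : choices) (v : 'I_(nv G)) : nat :=
  (r v * nv G + ins v)%N.

Lemma ins_lt_nv v : (ins v < nv G)%N.
Proof. exact: leq_trans (ins_lt_ext v) (ext_le v). Qed.

Lemma card_interval_choices :
  #|interval_choices| = (\prod_v (ext v - ins v))%N.
Proof.
rewrite cardsE card_family foldrE big_map big_enum /=.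
by apply: eq_bigr => v _; rewrite card_ord_itv.
Qed.

(** The interval of a parent ends before that of its child begins: [r u < ext u <= ins v <= r v]. *)
Lemma choice_potential_parents r :
  r \in interval_choices -> has_parents (choice_potential r).
Proof.
rewrite inE => /familyP rP v /parent_before[e [u [euv uv]]].
exists e, u; split=> //; rewrite /choice_potential.
have := rP u; have := rP v; rewrite !inE => /andP[rv _] /andP[_ ru].
have ruv : (r u < r v)%N by apply: leq_trans (leq_trans ru uv) rv.
apply: (@leq_trans ((r u).+1 * nv G)).
  by rewrite mulSn addnC ltn_add2r ins_lt_nv.
by apply: leq_trans (leq_addr _ _); rewrite leq_mul2r ruv orbT.
Qed.

(* The answer lists the vertices by nondecreasing [r], so it leaves at most as
   many possibilities for [r] as there are nondecreasing sequences. *)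
Lemma card_valid_choices (out : seq nat) :
  (#|[set r in interval_choices |
       `[< valid_answer (potential_weight R (choice_potential r)) out >]]|
     <= 4 ^ nv G)%N.
Proof.
set S := [set r in _ | _].
have [->|[r0]] := set_0Vmem S; first by rewrite cards0.
rewrite inE => /andP[_ /asboolP[permo _]].
have uo : uniq out by rewrite (perm_uniq permo) iota_uniq.
have so : size out = nv G by rewrite (perm_size permo) size_iota.
pose vtx (i : nat) : 'I_(nv G) := insubd (src G) (nth 0%N out i).
have vtxE i : (i < nv G)%N -> vtx i = nth 0%N out i :> nat.
  move=> lti; rewrite val_insubd; have := mem_nth 0%N (s := out) (n := i).
  by rewrite so (perm_mem permo) mem_iota /= add0n => /(_ lti) ->.
have index_vtx i : (i < nv G)%N -> index (vtx i : nat) out = i.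
  by move=> lti; rewrite vtxE // index_uniq // so.
(* Reading [r] in the order of the answer loses nothing, since [out] lists every vertex; what
   remains is that the tuple is nondecreasing. *)
pose f (r : choices) := [tuple r (vtx i) | i < nv G].
have f_inj : injective f.
  move=> r1 r2 E; apply/ffunP => v.
  have vo : (v : nat) \in out by rewrite (perm_mem permo) mem_iota /=.
  have iv : (index (v : nat) out < nv G)%N.
    by move: vo; rewrite -index_mem so.
  have := congr1 (fun t => tnth t (Ordinal iv)) E; rewrite !tnth_mktuple /=.
  suff -> : vtx (index (v : nat) out) = v by [].
  by apply: val_inj; rewrite /= vtxE // nth_index.
rewrite -(card_imset _ f_inj); apply: leq_trans (card_sorted_tuples_le _).
apply/subset_leq_card/fintype.subsetP => _ /imsetP[r rS ->]; rewrite inE.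
move: rS; rewrite inE => /andP[rS /asboolP[_ sorted_out]].
apply/(sortedP 0%N) => i; rewrite size_map size_tuple => iS.
have valE j : (j < nv G)%N -> nth 0%N [seq val i | i <- f r] j = r (vtx j).
  move=> jn; rewrite (nth_map (src G)) ?size_tuple //.
  by rewrite -[j]/(val (Ordinal jn)) -tnth_nth tnth_mktuple.
have lti := ltnW iS; have parents := choice_potential_parents rS.
rewrite !valE // leqNgt; apply/negP => ltr.
(* A descent of [r] would make the vertex at position [i.+1] strictly closer to the source, so a
   valid answer would list it first. *)
suff /sorted_out : dist (potential_weight R (choice_potential r)) (vtx i.+1) <
    dist (potential_weight R (choice_potential r)) (vtx i).
  by rewrite !index_vtx // ltnNge leqnSn.
rewrite !dist_potential // ltrD2r ltr_nat /choice_potential.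
apply: (@leq_trans ((r (vtx i.+1)).+1 * nv G)).
  by rewrite mulSn addnC ltn_add2r ins_lt_nv.
by apply: leq_trans (leq_addr _ _); rewrite leq_mul2r ltr orbT.
Qed.

(** Each choice in the intervals is one input; there are [\prod_v (ext v - ins v)] of them and an
    answer serves at most [4 ^ nv G], so the averaged bound applies to every correct algorithm. *)
Lemma OPT_Q_ge :
  (((\sum_v ln (ext v - ins v)%:R - (nv G)%:R * ln 4) / ln 3)%:E
     <= OPT_Q R G)%E.
Proof.
apply: le_ereal_inf_tmp => _ [A cA <-].
have S0 : (0 < #|interval_choices|)%N.
  by rewrite card_interval_choices prodn_gt0 // => v; rewrite subn_gt0.
have := @sup_expected_queries_ge R A G _ interval_choices
  (fun r => potential_weight R (choice_potential r)) (4 ^ nv G) cA.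
have -> : ln (#|interval_choices|%:R / (4 ^ nv G)%:R) =
    \sum_v ln (ext v - ins v)%:R - (nv G)%:R * ln 4 :> R.
  rewrite ln_div ?posrE ?ltr0n ?expn_gt0 // natrX lnXn // mulr_natl.
  rewrite card_interval_choices natr_prod; congr (_ - _).
  have [] // : 0 < \prod_v (ext v - ins v)%:R :> R /\
    ln (\prod_v (ext v - ins v)%:R) = \sum_v ln (ext v - ins v)%:R :> R.
  elim/big_rec2: _ => [|v x y _ [x0 IH]]; first by rewrite ltr01 ln1.
  have v0 : 0 < (ext v - ins v)%:R :> R by rewrite ltr0n subn_gt0.
  by rewrite mulr_gt0 // lnM ?posrE // IH.
apply=> //; last exact: card_valid_choices.
  by move=> r; exact: potential_weight_gt0.
by rewrite expn_gt0.
Qed.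

End Intervals.

(** * Queue histories, their invariants and their cost *)

Section Histories.
Set Implicit Arguments.
Unset Strict Implicit.
Unset Printing Implicit Defensive.
Variable R : realType.

Lemma inserted_rcons h ev : inserted (rcons h ev) =
  inserted h ++ (if ev is EvInsert x _ then [:: x] else [::]).
Proof. by rewrite -cats1 /inserted pmap_cat; case: ev. Qed.

Lemma extracted_rcons h ev : extracted (rcons h ev) =
  extracted h ++ (if ev is EvExtract x then [:: x] else [::]).
Proof. by rewrite -cats1 /extracted pmap_cat; case: ev. Qed.

Lemma current_key_rcons h ev : current_key (rcons h ev) =
  match ev with
  | EvInsert x k | EvDecrease x k => update (current_key h) x k
  | _ => current_key h
  end.
Proof. by rewrite /current_key -cats1 foldl_cat. Qed.

Lemma mem_present h x :
  (x \in present h) = (x \notin extracted h) && (x \in inserted h).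
Proof. by rewrite mem_filter. Qed.

Lemma working_set_cost_rcons h ev : working_set_cost R (rcons h ev) =
  working_set_cost R h + (if ev is EvExtract x
    then 1 + log2 (working_set_size h x)%:R else 1).
Proof.
rewrite /working_set_cost size_rcons big_ord_recr /=.
rewrite nth_rcons ltnn eqxx -cats1 take_size_cat //; congr (_ + _).
apply: eq_bigr => i _; rewrite nth_cat (ltn_ord i).
by rewrite takel_cat // ltnW.
Qed.

(** Every member of the working set was inserted no earlier than [x], so it lies in the suffix of
    [inserted h] that starts at [x]. *)
Lemma working_set_size_le h x : uniq (inserted h) ->
  (working_set_size h x <= size (inserted h) - index x (inserted h))%N.
Proof.
move=> uh; apply/bigmax_leqP => t _; rewrite -size_drop.
have hE : inserted h = inserted (take t h) ++ inserted (drop t h).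
  by rewrite /inserted -pmap_cat cat_take_drop.
apply: uniq_leq_size.
  by do 2!apply: filter_uniq; move: uh; rewrite hE cat_uniq => /andP[].
move=> y; rewrite mem_filter mem_present => /and3P[xy _ yt].
have yh : y \in inserted h by rewrite hE mem_cat yt.
move: (yh); rewrite -[X in y \in X](cat_take_drop (index x (inserted h))).
by rewrite mem_cat in_take // ltnNge xy.
Qed.

Lemma log2_natr_ge0 n : 0 <= log2 n%:R :> R.
Proof.
have ln20 : 0 < ln 2 :> R by rewrite ln_gt0 // ltr1n.
rewrite divr_ge0 ?(ltW ln20) //.
by case: n => [|n]; [rewrite ln0 | rewrite ln_ge0 // ler1n].
Qed.

Lemma log2_natr_le m n : (m <= n)%N -> (0 < n)%N ->
  log2 m%:R <= log2 n%:R :> R.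
Proof.
move=> mn n0; have ln20 : 0 < ln 2 :> R by rewrite ln_gt0 // ltr1n.
rewrite /log2 ler_pM2r ?invr_gt0 //; case: m mn => [_|m mn].
  by rewrite ln0 // ln_ge0 // ler1n.
by rewrite ler_ln ?posrE ?ltr0n // ler_nat.
Qed.

(** An element absent from [s] stays at index [size s] or beyond when [s] is extended. This
    preserves the extraction order while [y] is still pending. *)
Lemma index_cat_lt (T : eqType) (s s' : seq T) x y :
  x \in s -> (index x s < index y s)%N ->
  (index x (s ++ s') < index y (s ++ s'))%N.
Proof.
move=> xs xy; rewrite !index_cat xs; case: ifP => // _.
by apply: leq_trans (leq_addr _ _); rewrite index_mem.
Qed.

Variable G : graph.

(* [E x] is the number of elements inserted before the extraction of [x], and
   [done] is the set of edges whose relaxation called DecreaseKey. *)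
Record history_invariant (h : seq pq_event) (E : nat -> nat)
    (done : {set 'I_(ne G)}) : Prop := HistoryInvariant {
  inserted_uniq : uniq (inserted h);
  extracted_uniq : uniq (extracted h);
  extracted_sub : {subset extracted h <= inserted h};
  inserted_lt : forall x, x \in inserted h -> (x < nv G)%N;
  inserted_src : (src G : nat) \in inserted h;
  extraction_time : forall x, x \in extracted h ->
    (index x (inserted h) < E x <= size (inserted h))%N;
  discovered_from : forall v : 'I_(nv G), (v : nat) \in inserted h ->
    v != src G -> exists e (u : 'I_(nv G)),
    [/\ traverses e u v, (u : nat) \in extracted h,
        (E u <= index (v : nat) (inserted h))%N
      & (index (u : nat) (extracted h) < index (v : nat) (extracted h))%N];
  history_size :
    size h = (size (inserted h) + size (extracted h) + #|done|)%N;
  done_forward : forall e, e \in done -> exists u v : 'I_(nv G),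
    [/\ traverses e u v, (u : nat) \in extracted h
      & (index (u : nat) (extracted h) < index (v : nat) (extracted h))%N];
  history_cost : working_set_cost R h <= (size h)%:R +
    \sum_(x <- extracted h) log2 (E x - index x (inserted h))%:R }.

Lemma history_start k :
  history_invariant [:: EvInsert (src G) k] (fun=> 0%N) finset.set0.
Proof.
split=> //=.
- by move=> x; rewrite inE => /eqP ->.
- by rewrite inE.
- by move=> v; rewrite inE => /eqP/val_inj ->; rewrite eqxx.
- by rewrite cards0.
- by move=> e; rewrite inE.
- by rewrite /working_set_cost big_ord1 big_nil addr0.
Qed.

(** The index of the new [v] is the number of earlier insertions, which is at least [E u] because
    [u] has already been extracted. *)
Lemma history_insert h E done e (u v : 'I_(nv G)) k :
  history_invariant h E done -> (v : nat) \notin inserted h ->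
  (u : nat) \in extracted h -> traverses e u v ->
  history_invariant (rcons h (EvInsert v k)) E done.
Proof.
move=> [ui ue sub lt si et df hs dn hc] vi uh euv.
have vx : (v : nat) \notin extracted h by apply: contra vi; exact: sub.
have indexE x : x \in inserted h ->
    index x (inserted h ++ [:: (v : nat)]) = index x (inserted h).
  by move=> xh; rewrite index_cat xh.
split; rewrite ?inserted_rcons ?extracted_rcons ?cats0 //.
- by rewrite cat_uniq ui /= orbF vi.
- by move=> x xh; rewrite mem_cat sub.
- by move=> x; rewrite mem_cat inE => /orP[/lt//|/eqP ->].
- by rewrite mem_cat si.
- move=> x xh; have /andP[xE Es] := et x xh; rewrite indexE ?sub // xE.
  by rewrite size_cat (leq_trans Es) // leq_addr.
- move=> v'; rewrite mem_cat inE => /orP[vh|/eqP/val_inj -> vs].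
    by move=> /(df _ vh)[e' [u' H]]; exists e', u'; rewrite indexE.
  exists e, u; split=> //.
    rewrite index_cat (negbTE vi); apply: leq_trans (leq_addr _ _).
    by have /andP[] := et _ uh.
  by rewrite (memNindex vx) index_mem.
- by rewrite size_rcons hs size_cat addn1 !addSn.
- rewrite working_set_cost_rcons size_rcons -natr1 addrAC lerD2r.
  rewrite [X in _ <= _ + X](_ : _ =
    \sum_(x <- extracted h) log2 (E x - index x (inserted h))%:R) //.
  by apply: eq_big_seq => x xh; rewrite indexE ?sub.
Qed.

(** The extraction stamps [x] with the current number of insertions, so the working set of [x] has
    at most [E x - index x (inserted h)] elements for the new [E]; this pays for the new cost
    term. *)
Lemma history_extract h E done x :
  history_invariant h E done -> x \in inserted h -> x \notin extracted h ->
  history_invariant (rcons h (EvExtract x)) (update E x (size (inserted h)))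
    done.
Proof.
move=> [ui ue sub lt si et df hs dn hc] xi xx.
have updE y : y \in extracted h -> update E x (size (inserted h)) y = E y.
  by rewrite /update; case: eqP => // ->; rewrite (negbTE xx).
have updx : update E x (size (inserted h)) x = size (inserted h).
  by rewrite /update eqxx.
split; rewrite ?inserted_rcons ?extracted_rcons ?cats0 //.
- by rewrite cat_uniq ue /= orbF xx.
- by move=> y; rewrite mem_cat inE => /orP[/sub|/eqP ->].
- move=> y; rewrite mem_cat inE => /orP[yh|/eqP ->].
    by rewrite updE // et.
  by rewrite updx index_mem xi leqnn.
- move=> v vh /(df _ vh)[e [u [euv uh uE uv]]]; exists e, u.
  by rewrite updE // mem_cat uh index_cat_lt.
- by rewrite size_rcons hs size_cat /= addn1 addnS addSn.
- move=> e /dn[u [v [euv uh uv]]]; exists u, v.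
  by rewrite mem_cat uh index_cat_lt.
- rewrite working_set_cost_rcons size_rcons -natr1 big_cat big_seq1 /= updx.
  rewrite (eq_big_seq (fun y => log2 (E y - index y (inserted h))%:R));
    last first.
    by move=> y yh; rewrite updE.
  have := @log2_natr_le _ _ (working_set_size_le x ui).
  by rewrite subn_gt0 index_mem => /(_ xi); lra.
Qed.

(** As [v] is not yet extracted, its index lies beyond that of [u], so the edge is forward in the
    extraction order; [e] joining [done] accounts for the event. *)
Lemma history_decrease h E done e (u v : 'I_(nv G)) k :
  history_invariant h E done -> (u : nat) \in extracted h ->
  (v : nat) \notin extracted h -> traverses e u v -> e \notin done ->
  history_invariant (rcons h (EvDecrease v k)) E (e |: done)%SET.
Proof.
move=> [ui ue sub lt si et df hs dn hc] uh vh euv ed.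
split; rewrite ?inserted_rcons ?extracted_rcons ?cats0 //.
- by rewrite size_rcons hs cardsU1 ed addnCA add1n.
- move=> e'; rewrite !inE => /orP[/eqP ->|/dn//].
  by exists u, v; rewrite euv uh (memNindex vh) index_mem.
- by rewrite working_set_cost_rcons size_rcons -natr1 addrAC lerD2r.
Qed.

End Histories.

(** * Simulation of Dijkstra's algorithm alongside the queue history *)

Section Simulation.
Set Implicit Arguments.
Unset Strict Implicit.
Unset Printing Implicit Defensive.
Variables (R : realType) (Q : pqueue) (G : graph).
Hypothesis HQ : is_priority_queue R Q.

(** [tq] is the time spent inside the queue. Undiscovered vertices point to [infty_cell], which
    becomes their key on insertion. *)
Record state_invariant (h : seq pq_event) (mem : seq (\bar R))
    (st : dijkstra_state Q) (tq : nat) (E : nat -> nat)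
    (done : {set 'I_(ne G)}) : Prop := StateInvariant {
  queue_run : pq_run h mem (queue st) tq;
  memory_size : (1 < size mem)%N;
  was_insertedE : forall v, was_inserted st v = (v \in inserted h);
  was_extractedE : forall v, was_extracted st v = (v \in extracted h);
  dist_cell_key : forall v, v \in inserted h ->
    dist_cell st v = current_key h v;
  dist_cell_lt : forall v, (dist_cell st v < size mem)%N;
  dist_cell_undiscovered : forall v, v \notin inserted h ->
    dist_cell st v = infty_cell;
  history_inv : history_invariant R h E done }.

Lemma state_new_cells h mem st tq E done new :
  state_invariant h mem st tq E done ->
  state_invariant h (mem ++ new) st tq E done.
Proof.
move=> [rn ms wi we dk dl du hi]; split=> //; first exact: PQNewCells.
  by rewrite size_cat ltn_addr.
by move=> v; rewrite size_cat ltn_addr.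
Qed.

Lemma evals_read (A : Type) (f : nat -> A) i (mem : seq (\bar R)) tape :
  evals (read f i) mem tape (f i) mem tape 1 0.
Proof. by do 2!constructor. Qed.

Lemma evals_write (A : Type) (f : nat -> A) i a (mem : seq (\bar R)) tape :
  evals (write f i a) mem tape (update f i a) mem tape 1 0.
Proof. by do 2!constructor. Qed.

Lemma evals_add i j (mem : seq (\bar R)) tape :
  evals (Defs.add i j) mem tape (size mem)
    (rcons mem (cell mem i + cell mem j)%E) tape 1 0.
Proof. by do 2!constructor. Qed.

Lemma evals_compare i j (mem : seq (\bar R)) tape :
  evals (Defs.compare i j) mem tape (compare_cells mem i j) mem tape 1 1.
Proof. by do 2!constructor. Qed.

(** The 2 pays for the read and the write of [ins]; comparisons occur only inside the queue, whose
    time bounds them. *)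
Lemma discover_spec h mem st tq E done e (u v : 'I_(nv G)) tape :
  state_invariant h mem st tq E done -> (v : nat) \notin extracted h ->
  (u : nat) \in extracted h -> traverses e u v ->
  exists h' st' tq' tape' t q,
    [/\ evals (discover v st) mem tape st' mem tape' t q,
        state_invariant h' mem st' tq' E done,
        (v : nat) \in inserted h' /\ {subset inserted h <= inserted h'},
        extracted h' = extracted h
      & (t + tq <= tq' + 2)%N /\ (q + tq <= tq')%N].
Proof.
case: st => q ins ext D out Inv vx uh euv.
have [rn ms wi we dk dl du hi] := Inv.
have evr := evals_read ins v mem tape.
rewrite /discover; case vh : ((v : nat) \in inserted h).
  exists h, (DState q ins ext D out), tq, tape, (1 + 0)%N, (0 + 0)%N.
  split=> //; [|by split; rewrite ?vh|by rewrite add0n leqnn; lia].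
  by apply: evals_bind evr _; rewrite [ins v]wi vh; exact: EvalRet.
have ci : can_insert h mem (v : nat) infty_cell by split; rewrite ?vh.
have [/(_ _ _ ci)[q' [t' [c te]]] _ _ _] := HQ tape rn.
have [tape' ev] := (terminatesP _ _ _ _ _ _ _).1 te.
have qt := evals_queries_le_time ev.
pose st' := DState q' (update ins v true) ext D out.
exists (rcons h (EvInsert v infty_cell)), st', (tq + t')%N, tape',
  (1 + (t' + (1 + 0)))%N, (0 + (c + (0 + 0)))%N; split.
- apply: evals_bind evr _; rewrite [ins v]wi vh.
  apply: evals_bind ev _; apply: evals_bind (evals_write _ _ _ _ _) _.
  exact: EvalRet.
- split=> //=.
  + exact: PQInsert rn ci te.
  + move=> x; rewrite inserted_rcons mem_cat inE /update [ins x]wi.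
    by case: eqP => _; rewrite ?orbT ?orbF.
  + by move=> x; rewrite extracted_rcons cats0; exact: we.
  + move=> x; rewrite inserted_rcons mem_cat inE current_key_rcons /update.
    case: eqP => [->|_]; rewrite ?orbT ?orbF; last exact: dk.
    by move=> _; apply: du; rewrite vh.
  + by move=> x; rewrite inserted_rcons mem_cat negb_or => /andP[/du].
  + by apply: history_insert hi _ uh euv; rewrite vh.
- rewrite inserted_rcons mem_cat inE eqxx orbT; split=> // x xh.
  by rewrite mem_cat xh.
- by rewrite extracted_rcons cats0.
- lia.
Qed.

(** The single comparison outside the queue is charged to [e] joining [done]; the constant 9 absorbs
    the elementary operations. *)
Lemma relax_spec h mem st tq E done e (u v : 'I_(nv G)) du we tape :
  state_invariant h mem st tq E done -> (u : nat) \in extracted h ->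
  traverses e u v -> ((v : nat) \notin extracted h -> e \notin done) ->
  exists h' mem' st' tq' done' tape' t q,
    [/\ evals (relax du v we st) mem tape st' mem' tape' t q,
        state_invariant h' mem' st' tq' E done',
        (v : nat) \in inserted h' /\ {subset inserted h <= inserted h'},
        extracted h' = extracted h /\ {subset done' <= e |: done}%SET
      & (t + tq <= tq' + 9)%N /\ (q + tq + #|done| <= tq' + #|done'|)%N].
Proof.
move=> Inv uh euv ed.
have evr := evals_read (was_extracted st) v mem tape.
case vx : ((v : nat) \in extracted h).
  exists h, mem, st, tq, done, tape, (1 + 0)%N, (0 + 0)%N; split=> //.
  - apply: evals_bind evr _; rewrite (was_extractedE Inv) vx; exact: EvalRet.
  - by split=> //; apply: (extracted_sub (history_inv Inv)).
  - by split=> // x; rewrite !inE => ->; rewrite orbT.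
  - by lia.
have [|h1 [[q ins ext D out] [tq1 [tape1 [t1 [q1 [ev1 Inv1 [vi sub] ex1 [tl
  ql]]]]]]]] :=
  discover_spec tape Inv _ uh euv; first by rewrite vx.
pose mem1 := rcons mem (cell mem du + cell mem we)%E.
have Inv2 : state_invariant h1 mem1 (DState q ins ext D out) tq1 E done.
  by rewrite /mem1 -cats1; exact: state_new_cells.
pose dv' := if compare_cells mem1 (size mem) (D v) is Lt then size mem else D v.
have [rn ms wi wx dk dl dund hi] := Inv2.
have cd : can_decrease h1 mem1 v dv'.
  split; first by rewrite mem_present ex1 vx.
    rewrite /dv'; case: compare_cells; try exact: (dl v).
    by rewrite /mem1 size_rcons.
  (* The chosen cell holds the smaller of the two values, so the key does not increase. *)
  rewrite -(dk _ vi) /= /dv' /compare_cells.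
  by case: ifP => [/ltW//|_]; case: ifP.
have [_ _ _ /(_ _ _ cd)[q' [t' [c te]]]] := HQ tape1 rn.
have [tape' ev] := (terminatesP _ _ _ _ _ _ _).1 te.
have qt := evals_queries_le_time ev.
exists (rcons h1 (EvDecrease v dv')), mem1, (DState q' ins ext (update D v dv')
  out),
  (tq1 + t')%N, (e |: done)%SET, tape',
  (1 + (t1 + (1 + (1 + (1 + (1 + (t' + 0)))))))%N,
  (0 + (q1 + (0 + (0 + (1 + (0 + (c + 0)))))))%N; split.
- apply: evals_bind evr _; rewrite (was_extractedE Inv) vx.
  apply: evals_bind ev1 _; apply: evals_bind (evals_add _ _ _ _) _.
  apply: evals_bind (evals_read _ _ _ _) _.
  apply: evals_bind (evals_compare _ _ _ _) _.
  apply: evals_bind (evals_write _ _ _ _ _) _.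
  apply: evals_bind ev _; exact: EvalRet.
- split=> //=.
  + exact: PQDecreaseKey rn cd te.
  + by move=> x; rewrite inserted_rcons cats0; exact: wi.
  + by move=> x; rewrite extracted_rcons cats0; exact: wx.
  + move=> x; rewrite inserted_rcons cats0 current_key_rcons /update.
    by case: eqP => // _; exact: dk.
  + by move=> x; rewrite /update; case: eqP => _; [case: cd | exact: dl].
  + move=> x; rewrite inserted_rcons cats0 /update.
    by case: eqP => [->|_]; [rewrite vi | exact: dund].
  + by apply: history_decrease hi _ _ euv _; rewrite ?ex1 ?vx ?ed ?vx.
- by rewrite inserted_rcons cats0; split.
- by rewrite extracted_rcons cats0 ex1; split.
- by rewrite cardsU1 ed ?vx //=; lia.
Qed.

(** * Adjacency lists and the main loop *)

Definition incident (u : nat) (e : 'I_(ne G)) : bool :=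
  (edge_tail e == u :> nat) || ~~ directed G && (edge_head e == u :> nat).

Definition other_end (u : 'I_(nv G)) (e : 'I_(ne G)) : 'I_(nv G) :=
  if edge_tail e == u then edge_head e else edge_tail e.

Lemma adjacencyE (u : 'I_(nv G)) : adjacency G u =
  [seq (other_end u e : nat, weight_cell e)
  | e <- [seq e <- enum 'I_(ne G) | incident u e]].
Proof.
by apply: eq_map => e; rewrite /other_end -val_eqE /=; case: ifP.
Qed.

Lemma traverses_other_end (u : 'I_(nv G)) e :
  incident u e -> traverses e u (other_end u e).
Proof.
rewrite /incident /traverses /other_end !val_eqE.
by case: eqVneq => [->|_] /=; rewrite ?eqxx ?andbT.
Qed.

Lemma traversesE e (u v : 'I_(nv G)) :
  traverses e u v -> incident u e /\ v = other_end u e.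
Proof.
rewrite /incident /other_end !val_eqE.
case/orP=> [/andP[/eqP -> /eqP ->]|/andP[/andP[dG /eqP hu] /eqP tv]].
  by rewrite eqxx.
by rewrite dG hu eqxx orbT; split=> //; case: eqP => //; rewrite tv.
Qed.

(** Each entry costs the 9 of [relax_spec] and one for fetching it. The edges are distinct, so
    relaxing one does not put a later one into [done]. *)
Lemma relax_all_spec (u : 'I_(nv G)) du (es : seq 'I_(ne G)) h mem st tq E done
    tape :
  uniq es -> all (incident u) es ->
  state_invariant h mem st tq E done -> (u : nat) \in extracted h ->
  (forall e, e \in es -> (other_end u e : nat) \notin extracted h ->
     e \notin done) ->
  exists h' mem' st' tq' done' tape' t q,
    [/\ evals (relax_all du [seq (other_end u e : nat, weight_cell e) | e <-
      es] st)
          mem tape st' mem' tape' t q,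
        state_invariant h' mem' st' tq' E done',
        (forall e, e \in es -> (other_end u e : nat) \in inserted h') /\
          {subset inserted h <= inserted h'},
        extracted h' = extracted h /\
          (forall e, e \in done' -> e \in done \/ e \in es)
      & (t + tq <= tq' + 10 * size es)%N /\
          (q + tq + #|done| <= tq' + #|done'|)%N].
Proof.
elim: es h mem st tq done tape => [|e es IH] h mem st tq done tape /=.
  move=> _ _ Inv uh _.
  exists h, mem, st, tq, done, tape, 0%N, 0%N.
  by split; [exact: EvalRet|exact: Inv|split|split=> // e; left|rewrite addn0].
move=> /andP[ees ues] /andP[ie ies] Inv uh nd.
have [|h1 [m1 [st1 [tq1 [done1 [tape1 [t1 [q1 [ev1 Inv1 [vi1 sub1] [ex1 dn1]
  [tl1 ql1]]]]]]]]]] :=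
  relax_spec du (weight_cell e) tape Inv uh (traverses_other_end ie).
  by apply: nd; rewrite inE eqxx.
have [||h2 [m2 [st2 [tq2 [done2 [tape2 [t2 [q2 [ev2 Inv2 [vi2 sub2] [ex2 dn2]
  [tl2 ql2]]]]]]]]]] :=
  IH h1 m1 st1 tq1 done1 tape1 ues ies Inv1.
- by rewrite ex1.
- move=> e' e'es; rewrite ex1 => vx; apply/negP => /dn1; rewrite !inE.
  case/orP=> [/eqP e'e|]; first by rewrite -e'e e'es in ees.
  by apply/negP; apply: nd vx; rewrite inE e'es orbT.
exists h2, m2, st2, tq2, done2, tape2, (t1 + t2).+1, (q1 + q2)%N; split=> //.
- by constructor; apply: evals_bind ev1 ev2.
- split=> [e'|x /sub1/sub2//]; rewrite inE => /orP[/eqP ->|/vi2//].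
  exact: sub2.
- rewrite ex2 ex1; split=> // e' /dn2[/dn1|e'es].
    by rewrite !inE => /orP[->|->]; [right|left].
  by right; rewrite inE e'es orbT.
- split; first by lia.
  by move: (#|done|) (#|done1|) (#|done2|) ql1 ql2 => *; lia.
Qed.

(* Holds between two iterations of the main loop, but not during a scan. *)
Definition scanned (h : seq pq_event) (done : {set 'I_(ne G)}) : Prop :=
  (forall e (u v : 'I_(nv G)), (u : nat) \in extracted h -> traverses e u v ->
     (v : nat) \in inserted h) /\
  (forall e, e \in done -> exists2 u : 'I_(nv G),
     incident u e & (u : nat) \in extracted h).

(** Were the queue empty, the extracted vertices would contain the source and be closed under
    traversing edges, hence be all vertices by connectivity. *)
Lemma present_neq_nil h mem st tq E done :
  state_invariant h mem st tq E done -> scanned h done ->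
  (size (extracted h) < nv G)%N -> present h != [::].
Proof.
move=> /history_inv Inv [cl _]; rewrite ltnNge; apply: contra => /eqP p0.
have ie x : x \in inserted h -> x \in extracted h.
  by move=> xi; have := mem_present h x; rewrite p0 xi andbT => /esym/negbFE.
have reach (u : 'I_(nv G)) p v :
    (u : nat) \in extracted h -> walk u p v -> (v : nat) \in extracted h.
  elim: p u => [|e p IH] u /=; first by move=> uh /eqP <-.
  by move=> uh /existsP[x /andP[eux]]; apply: IH; apply: ie; exact: cl uh eux.
have all_extracted (v : 'I_(nv G)) : (v : nat) \in extracted h.
  have [p sp] : exists p, walk (src G) p v.
    by have := graph_connected G; case: ifP.
  by apply: reach sp; apply: ie; exact: inserted_src Inv.
rewrite -[X in (X <= _)%N](size_iota 0); apply: uniq_leq_size (iota_uniq _ _) _.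
by move=> x; rewrite mem_iota => /andP[_ xn];
  exact: (all_extracted (Ordinal xn)).
Qed.

(** Measures the time outside the queue: one unit per adjacency entry and one for the overhead of
    each iteration. *)
Definition scan_work (h : seq pq_event) : nat :=
  (\sum_(u <- extracted h) (size (adjacency G u)).+1)%N.

(** Outside the queue, time is paid by the growth of [scan_work] and comparisons by the growth of
    [done]. *)
Lemma dijkstra_loop_spec k h mem st tq E done tape :
  state_invariant h mem st tq E done -> scanned h done ->
  (size (extracted h) + k)%N = nv G ->
  exists out h' mem' st' tq' E' done' tape' t q,
    [/\ evals (dijkstra_loop G k st) mem tape out mem' tape' t q,
        state_invariant h' mem' st' tq' E' done',
        size (extracted h') = nv G,
        (t + tq + 10 * scan_work h <= tq' + 10 * scan_work h' + 1)%N
      & (q + tq + #|done| <= tq' + #|done'|)%N].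
Proof.
elim: k h mem st tq E done tape => [|k IH] h mem st tq E done tape Inv sc.
  rewrite addn0 => sz.
  exists (output st), h, mem, st, tq, E, done, tape, 1%N, 0%N; split=> //.
  - by do 2!constructor.
  - by lia.
move=> sz; have p0 : present h != [::].
  by apply: present_neq_nil Inv sc _; rewrite -sz addnS ltnS leq_addr.
have [rn ms wi wx dk dl dund hi] := Inv.
have [_ _ /(_ p0)[q1 [x [du [t1 [c1 [te [xp _ _]]]]]]] _] := HQ tape rn.
have [tape1 ev1] := (terminatesP _ _ _ _ _ _ _).1 te.
have qt1 := evals_queries_le_time ev1.
move: xp; rewrite mem_present => /andP[xx xi].
pose u := Ordinal (inserted_lt hi xi); have uE : (u : nat) = x by [].
pose h1 := rcons h (EvExtract x).
pose E1 := update E x (size (inserted h)).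
pose st1 := DState q1 (was_inserted st) (update (was_extracted st) x true)
  (dist_cell st) (rcons (output st) x).
have ih1 : inserted h1 = inserted h by rewrite inserted_rcons cats0.
have xh1 : extracted h1 = rcons (extracted h) x.
  by rewrite extracted_rcons cats1.
have Inv1 : state_invariant h1 mem st1 (tq + t1) E1 done.
  split=> //=; rewrite ?ih1 //.
  - exact: PQExtractMin rn p0 te.
  - by move=> v; rewrite xh1 mem_rcons inE /update -wx; case: eqP.
  - by move=> v vi; rewrite current_key_rcons; exact: dk.
  - exact: history_extract.
pose es := [seq e <- enum 'I_(ne G) | incident u e].
have [||||h2 [m2 [st2 [tq2 [done2 [tape2 [t2 [q2 [ev2 Inv2 [vi2 sub2] [ex2 dn2]
  [tl2 ql2]]]]]]]]]] :=
  @relax_all_spec u du es h1 mem st1 _ E1 done tape1 _ _ Inv1.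
- by rewrite filter_uniq // enum_uniq.
- exact: filter_all.
- by rewrite xh1 mem_rcons inE eqxx.
- move=> e;
    rewrite mem_filter xh1 mem_rcons inE negb_or => /andP[ie _] /andP[ox oh].
  (* Had [e] been relaxed before, it would be incident to an extracted [u'] other than [u]; this
     would be its other end, which is not extracted. *)
  apply/negP => /sc.2[u' iu' u'h].
  have u'u : u' != u by apply: contraNneq xx => u'u; rewrite -uE -u'u.
  suff u'o : u' = other_end u e by rewrite -u'o u'h in oh.
  move: iu' ie u'u; rewrite /incident /other_end !val_eqE.
  case: (eqVneq (edge_tail e) u) => [->|tu] /=.
    by rewrite eq_sym => /orP[->//|/andP[_ /eqP ->]].
  by case/orP=> [/eqP -> //|/andP[_ /eqP <-] /andP[_ /eqP ->]]; rewrite eqxx.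
have sz2 : size (extracted h2) = (size (extracted h)).+1.
  by rewrite ex2 xh1 size_rcons.
have sc2 : scanned h2 done2.
  split=> [e a b|e].
    rewrite ex2 xh1 mem_rcons inE => /orP[/eqP au eab|ah eab].
      have {}au : a = u by apply: val_inj.
      have [ie ->] := traversesE eab; rewrite au; apply: vi2.
      by rewrite mem_filter mem_enum andbT -au.
    by apply: sub2; rewrite ih1; exact: sc.1 eab.
  rewrite ex2 xh1 => /dn2[/sc.2[u' iu' u'h]|].
    by exists u' => //; rewrite mem_rcons inE u'h orbT.
  rewrite mem_filter => /andP[ie _]; exists u => //.
  by rewrite mem_rcons inE eqxx.
have [|out [h3 [m3 [st3 [tq3 [E3 [done3 [tape3 [t3 [q3 [ev3 Inv3 sz3 tl3
  ql3]]]]]]]]]]] :=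
  IH h2 m2 st2 tq2 E1 done2 tape2 Inv2 sc2; first by rewrite sz2 addSnnS.
exists out, h3, m3, st3, tq3, E3, done3, tape3,
  (t1 + (1 + (t2 + t3).+1)).+1, (c1 + (0 + (q2 + q3)))%N; split=> //.
- have -> : dijkstra_loop G k.+1 st = Op (
      let! (q', (u, du)) := pq_extract_min (queue st) in
      let! ext' := write (was_extracted st) u true in
      Op (let! st' := relax_all du (adjacency G u)
            (DState q' (was_inserted st) ext' (dist_cell st)
               (rcons (output st) u)) in dijkstra_loop G k st')).
    by case: (st).
  constructor; apply: evals_bind ev1 _;
    apply: evals_bind (evals_write _ _ _ _ _) _.
  constructor; apply: evals_bind _ ev3.
  by rewrite -uE adjacencyE.
- have sw : scan_work h2 = (scan_work h + (size es).+1)%N.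
    rewrite /scan_work ex2 xh1 -cats1 big_cat big_seq1 /=.
    by rewrite -uE adjacencyE size_map.
  by move: tl2 tl3; rewrite sw; lia.
- by move: (#|done|) (#|done2|) (#|done3|) ql2 ql3 => *; lia.
Qed.

(** Double counting: an edge occurs in the adjacency lists of at most its two endpoints. *)
Lemma scan_work_le h E (done : {set 'I_(ne G)}) : history_invariant R h E done
  ->
  (scan_work h <= 2 * ne G + nv G)%N.
Proof.
move=> Inv; apply: (@leq_trans (\sum_(u < nv G) (size (adjacency G u)).+1)).
  rewrite /scan_work -(big_mkord xpredT (fun u => (size (adjacency G u)).+1)).
  rewrite /index_iota subn0; apply: (@leq_trans (\sum_(u <- iota 0 (nv G)
    | u \in extracted h) (size (adjacency G u)).+1)); last first.
    by rewrite [leqRHS](bigID (mem (extracted h))) /= leq_addr.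
  rewrite -[leqRHS]big_filter; apply: eq_leq; apply: perm_big; apply: uniq_perm.
  - exact: extracted_uniq Inv.
  - by rewrite filter_uniq // iota_uniq.
  move=> x; rewrite mem_filter mem_iota /= add0n.
  by case xh: (x \in extracted h) => //=;
    rewrite (inserted_lt Inv) ?(extracted_sub Inv).
under eq_bigr => u _ do rewrite -addn1.
rewrite big_split /= sum1_card card_ord leq_add2r.
have -> : (\sum_(u < nv G) size (adjacency G u) =
    \sum_(e < ne G) \sum_(u < nv G) incident u e)%N.
  rewrite exchange_big /=; apply: eq_bigr => u _.
  rewrite adjacencyE size_map size_filter -sum1_count big_enum_cond /=.
  by rewrite big_mkcond /=; apply: eq_bigr => e _; case: incident.
rewrite mulnC -[X in (_ <= X * _)%N]card_ord -sum_nat_const;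
  apply: leq_sum => e _.
apply: (@leq_trans (\sum_(u < nv G) ((u == edge_tail e) + (u == edge_head e)))).
  apply: leq_sum => u _; rewrite /incident !val_eqE ![u == _]eq_sym.
  by case: (edge_tail e == u); case: (edge_head e == u); case: directed.
have count1 (x : 'I_(nv G)) : (\sum_(u < nv G) (u == x) = 1)%N.
  by rewrite (bigD1 x) //= eqxx big1 // => i /negbTE ->.
by rewrite big_split /= !count1.
Qed.

Lemma dijkstra_spec (w : 'I_(ne G) -> R) tape :
  exists out h mem tq E done t q,
    [/\ terminates (dijkstra Q G) (init_cells w) tape out mem t q,
        exists m st, state_invariant h m st tq E done,
        size (extracted h) = nv G,
        (t <= tq + 20 * ne G + 20 * nv G)%N
      & (q <= tq + #|done|)%N].
Proof.
pose mem := init_cells w.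
have ci : can_insert [::] mem (src G) zero_cell by [].
have rn0 := PQStart Q mem.
have [/(_ _ _ ci)[q1 [t1 [c1 te]]] _ _ _] := HQ tape rn0.
have [tape1 ev1] := (terminatesP _ _ _ _ _ _ _).1 te.
have qt1 := evals_queries_le_time ev1.
pose h1 := [:: EvInsert (src G) zero_cell].
pose st1 := DState q1 (update (fun=> false) (src G) true) (fun=> false)
  (update (fun=> infty_cell) (src G) zero_cell) [::].
have Inv1 : state_invariant h1 mem st1 t1 (fun=> 0%N) finset.set0.
  split=> //=.
  - exact: PQInsert rn0 ci te.
  - by move=> v; rewrite inE /current_key /= /update => ->.
  - by move=> v; rewrite /update; case: eqP.
  - by move=> v; rewrite inE /update => /negbTE ->.
  - exact: history_start.
have sc1 : scanned h1 finset.set0 by split=> // e; rewrite inE.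
have [out [h [m [st [tq [E [done [tape' [t [q [ev Inv sz tl ql]]]]]]]]]]] :=
  dijkstra_loop_spec tape1 Inv1 sc1 (add0n _).
exists out, h, m, tq, E, done, (3 * nv G + (t1 + (1 + (1 + t))))%N,
  (c1 + (0 + (0 + q)))%N; split=> //.
- apply/terminatesP; exists tape'; apply: evals_iter_op.
  apply: evals_bind ev1 _; apply: evals_bind (evals_write _ _ _ _ _) _.
  by apply: evals_bind (evals_write _ _ _ _ _) _.
- by exists m, st.
(* The scans cost at most [20 * ne G + 10 * nv G]; initialization and additive constants fit into
   the rest because the source gives [0 < nv G]. *)
- have := scan_work_le (history_inv Inv).
  have : (0 < nv G)%N by case: (src G) => ?; apply: leq_ltn_trans.
  by move: tl; rewrite /scan_work big_nil; lia.
- by move: ql; rewrite cards0; lia.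
Qed.

End Simulation.

(** * Cost of a complete history in terms of [OPT_Q] and forward edges *)

Section Bounds.
Set Implicit Arguments.
Unset Strict Implicit.
Unset Printing Implicit Defensive.
Variables (R : realType) (G : graph).

Lemma OPT_Q_ge0 : (0 <= OPT_Q R G)%E.
Proof.
apply: le_ereal_inf_tmp => _ [A _ <-].
apply: (@le_trans _ _ (@expected_queries R A G (fun=> 1))).
  by apply: integral_ge0 => x _; exact: total_queries_ge0.
by apply: ereal_sup_ubound; exists (fun=> 1).
Qed.

Variables (h : seq pq_event) (E : nat -> nat) (done : {set 'I_(ne G)}).
Hypothesis Inv : history_invariant R h E done.
Hypothesis all_extracted : size (extracted h) = nv G.

Lemma perm_extracted : perm_eq (extracted h) (iota 0 (nv G)).
Proof.
apply: uniq_perm; rewrite ?iota_uniq ?(extracted_uniq Inv) //.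
have [||] // := uniq_min_size (extracted_uniq Inv) (s2 := iota 0 (nv G)).
  by move=> x /(extracted_sub Inv)/(inserted_lt Inv); rewrite mem_iota.
by rewrite size_iota all_extracted.
Qed.

Lemma mem_extracted (v : 'I_(nv G)) : (v : nat) \in extracted h.
Proof. by rewrite (perm_mem perm_extracted) mem_iota /=. Qed.

Lemma size_inserted_le : (size (inserted h) <= nv G)%N.
Proof.
rewrite -[X in (_ <= X)%N](size_iota 0).
apply: uniq_leq_size (inserted_uniq Inv) _ => x /(inserted_lt Inv).
by rewrite mem_iota.
Qed.

(** With the extraction index as potential, parents precede their children and every edge in [done]
    is forward for the induced weights. *)
Lemma card_done_le : (#|done| <= max_forward R G)%N.
Proof.
pose D (v : 'I_(nv G)) := index (v : nat) (extracted h).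
have parD : has_parents D.
  move=> v vs; have vi := extracted_sub Inv (mem_extracted v).
  by have [e [u [euv _ _ uv]]] := discovered_from Inv vi vs; exists e, u.
apply: leq_trans (card_forward_le (potential_weight_gt0 R D)).
apply/subset_leq_card/fintype.subsetP => e /(done_forward Inv)[u [v [euv _
  uv]]].
rewrite forward_potential //; move: euv; rewrite /traverses.
case: ifP => /= _; rewrite inE /D ?orbF.
  by move=> /andP[/eqP -> /eqP ->].
case/orP=> /andP[/eqP -> /eqP ->]; first by rewrite ltn_eqF.
by rewrite gtn_eqF.
Qed.

(** The lower bound for the insertion and extraction times controls the sum of logarithms; the
    history itself has at most [2 * nv G + #|done|] operations. *)
Lemma history_cost_le (r : R) : OPT_Q R G = r%:E ->
  working_set_cost R h <= 4 * (nv G)%:R + #|done|%:R + 2 * r.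
Proof.
move=> optE; have r0 : 0 <= r by rewrite -lee_fin -optE; exact: OPT_Q_ge0.
have ln20 : 0 < ln 2 :> R by rewrite ln_gt0 // ltr1n.
have ln30 : 0 < ln 3 :> R by rewrite ln_gt0 // ltr1n.
have ln4 : ln 4 = 2 * ln 2 :> R.
  by rewrite -[4]/((2 * 2)%:R) natrM lnM ?posrE ?ltr0n // mulr2n mulrDl mul1r.
have ln34 : ln 3 <= 2 * ln 2 :> R.
  by rewrite -ln4 ler_ln ?posrE // ler_nat.
pose ins (v : 'I_(nv G)) := index (v : nat) (inserted h).
pose ext (v : 'I_(nv G)) := E v.
set S := \sum_v ln (ext v - ins v)%:R : R.
have lb : S - (nv G)%:R * ln 4 <= r * ln 3.
  rewrite -ler_pdivrMr // -lee_fin -optE; apply: OPT_Q_ge.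
  - by move=> v; have /andP[] := extraction_time Inv (mem_extracted v).
  - move=> v; have /andP[_] := extraction_time Inv (mem_extracted v).
    by move=> /leq_trans; apply; exact: size_inserted_le.
  - move=> v vs; have vi := extracted_sub Inv (mem_extracted v).
    by have [e [u [euv _ uv _]]] := discovered_from Inv vi vs; exists e, u.
have sumE : \sum_(x <- extracted h) log2 (E x - index x (inserted h))%:R =
    S / ln 2.
  rewrite (perm_big _ perm_extracted) /= mulr_suml.
  have -> : iota 0 (nv G) = index_iota 0 (nv G) by rewrite /index_iota subn0.
  by rewrite big_mkord.
(* Both constants come from [ln 4 = 2 * ln 2] and [ln 3 <= 2 * ln 2]. *)
have S_le : S / ln 2 <= 2 * r + 2 * (nv G)%:R.
  rewrite ler_pdivrMr //; have : r * ln 3 <= r * (2 * ln 2) by apply: ler_wpM2l.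
  by move: lb; rewrite ln4; lra.
have sz : (size h)%:R <= 2 * (nv G)%:R + #|done|%:R :> R.
  rewrite -natrM -natrD ler_nat (history_size Inv) all_extracted.
  by rewrite leq_add2r mul2n -addnn leq_add2r size_inserted_le.
by have := history_cost Inv; rewrite sumE; lra.
Qed.

End Bounds.

Theorem mainTheorem1 (R : realType) (Q : pqueue)
    (HQ : fibonacci_like_working_set R Q) :
  exists2 C : R, 0 < C &
    forall (G : graph) (w : 'I_(ne G) -> R), positive w ->
    forall tape : nat -> bool,
    exists (out : seq nat) (mem : seq (\bar R)) (t q : nat),
      [/\ terminates (dijkstra Q G) (init_cells w) tape out mem t q,
          (t%:R%:E <= C%:E * (OPT_Q R G + (ne G)%:R%:E + (nv G)%:R%:E))%E
        & (q%:R%:E <=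
           C%:E * (OPT_Q R G + (nv G)%:R%:E + (max_forward R G)%:R%:E))%E].
Proof.
case: HQ => pq [c costQ]; have c0 := normr_ge0 c.
(* The first term covers the time inside the queue, the 20 everything outside it; [c] may be
   negative, hence its absolute value. *)
exists (4 * `|c| + 20) => [|G w w0 tape]; first by lra.
have [out [h [mem [tq [E [done [t [q [te [m [st Inv]] sz tl ql]]]]]]]]] :=
  dijkstra_spec pq w tape.
exists out, mem, t, q; have hi := history_inv Inv.
have n0 : 0 <= (nv G)%:R :> R by [].
have d0 : 0 <= #|done|%:R :> R by [].
have dm : #|done|%:R <= (ne G)%:R :> R.
  by rewrite ler_nat -[leqRHS]card_ord max_card.
have df : #|done|%:R <= (max_forward R G)%:R :> R.
  by rewrite ler_nat (card_done_le hi sz).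
have tR : t%:R <= tq%:R + 20 * (ne G)%:R + 20 * (nv G)%:R :> R.
  by rewrite -!natrM -!natrD ler_nat.
have qR : q%:R <= tq%:R + #|done|%:R :> R by rewrite -natrD ler_nat.
have C0 : 0 < 4 * `|c| + 20 by lra.
have optE0 := OPT_Q_ge0 R G; have cost_le := history_cost_le hi sz.
(* If [OPT_Q] is infinite, both bounds are trivial. *)
case: (OPT_Q R G) optE0 cost_le => [r r0 /(_ _ erefl) cost_le|_ _|//];
  last first.
  by split=> //; rewrite !addye // gt0_muley ?lte_fin // leey.
have {}r0 : 0 <= r by [].
have tqR : tq%:R <= `|c| * (4 * (nv G)%:R + #|done|%:R + 2 * r).
  apply: le_trans (costQ _ _ _ _ (queue_run Inv)) _.
  apply: (@le_trans _ _ (`|c| * working_set_cost R h)); last exact: ler_wpM2l.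
  apply: ler_wpM2r; last exact: ler_norm.
  apply: sumr_ge0 => i _; case: (nth _ _ _) => // x.
  by rewrite addr_ge0 // log2_natr_ge0.
split=> //; rewrite -!EFinD -EFinM lee_fin; nra.
Qed.
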